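(* Let $n,k,h$ be integers with $0<k<n$ and $h\geq 2$, suppose $n\neq hk$, and let $i=\min(n,hk)$. If $n\neq 2$, then the fundamental group of $\mathcal{F}_h^{i}(k,n)$ is trivial. If $n=2$, then the fundamental group of $\mathcal{F}_h^{i}(k,n)$ is isomorphic to the pure braid group on $h$ strings of the sphere, $\pi_1(\mathcal{F}_h(\mathbb{C}\mathbb{P}^1))$.
   Context: $Gr(k,n)$ is the complex Grassmannian manifold parametrizing the $k$-dimensional linear subspaces of $\mathbb{C}^n$, with $0<k<n$. For a manifold $M$, $\mathcal{F}_h(M)=\{(x_1,\ldots,x_h)\in M^h\mid x_a\neq x_b \text{ for } a\neq b\}$ is the ordered configuration space of $h$ distinct points in $M$, and the pure braid group on $h$ strings of $M$ is $\pi_1(\mathcal{F}_h(M))$. The $i$th ordered configuration space is $$\mathcal{F}_h^i(k,n)=\{(H_1,\ldots,H_h)\in\mathcal{F}_h(Gr(k,n))\mid \dim(H_1+\cdots+H_h)=i\},$$ topologized as a subspace of $Gr(k,n)^h$. *)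

(* Defs.v *)
From HB Require Import structures.
From mathcomp Require Import all_boot all_order all_algebra generic_quotient.
From mathcomp Require Import all_classical all_reals topology normedtype homotopy.
From mathcomp Require Import complex lra.

Set Implicit Arguments.
Unset Strict Implicit.
Unset Printing Implicit Defensive.

Import Order.TTheory GRing.Theory Num.Theory numFieldNormedType.Exports.

Local Open Scope classical_set_scope.
Local Open Scope quotient_scope.
Local Open Scope ring_scope.

Lemma continuous_if_le (R : realType) (X Y : topologicalType) (u : X -> R)
    (c : R) (f g : X -> Y) :
  continuous u -> continuous f -> continuous g ->
  (forall x, u x = c -> f x = g x) ->
  continuous (fun x => if u x <= c then f x else g x).
Proof.
move=> cu cf cg fg x U /=; have [uxc|cux|uxc] := ltgtP (u x) c => xU.
- have fU : \forall y \near x, U (f y) by exact: cf.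
  have near_lt : \forall y \near x, u y < c by exact: cu (lt_nbhsl uxc).
  by apply: filterS2 fU near_lt => y Uy /ltW uyc; rewrite /= uyc.
- have gU : \forall y \near x, U (g y) by exact: cg.
  have near_gt : \forall y \near x, c < u y by exact: cu (lt_nbhsr cux).
  by apply: filterS2 gU near_gt => y Uy cuy; rewrite /= leNgt cuy.
- have fU : \forall y \near x, U (f y) by exact: cf.
  have gU : \forall y \near x, U (g y) by apply: cg; rewrite -fg.
  by apply: filterS2 fU gU => y Ufy Ugy; rewrite /=; case: ifP.
Qed.

Section UnitInterval.
Variable R : realType.

Definition unit_itv : Type := set_type `[0 : R, 1 : R].
HB.instance Definition _ := Topological.on unit_itv.

Lemma clamp_subproof (r : R) : Num.max 0 (Num.min 1 r) \in `[0 : R, 1 : R]%classic.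
Proof. by rewrite inE/= in_itv/= le_max lexx/= ge_max ler01 ge_min lexx. Qed.

Definition clamp (r : R) : unit_itv :=
  exist (fun x => x \in `[0 : R, 1 : R]%classic) _ (clamp_subproof r).

Lemma unit_itv_ge0 (t : unit_itv) : 0 <= val t.
Proof. by have := set_valP t; rewrite /= in_itv/= => /andP[]. Qed.

Lemma unit_itv_le1 (t : unit_itv) : val t <= 1.
Proof. by have := set_valP t; rewrite /= in_itv/= => /andP[]. Qed.

Lemma val_clamp (r : R) : 0 <= r -> r <= 1 -> val (clamp r) = r.
Proof. by move=> r0 r1; rewrite /= min_r// max_r. Qed.

Lemma clampK (t : unit_itv) : clamp (val t) = t.
Proof. by apply: val_inj; rewrite val_clamp ?unit_itv_ge0 ?unit_itv_le1. Qed.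

Lemma clamp_le0 (r : R) : r <= 0 -> clamp r = clamp 0.
Proof.
move=> r0; apply: val_inj; rewrite /clamp/= (min_r ler01) maxxx max_l//.
by rewrite ge_min r0 orbT.
Qed.

Lemma clamp_ge1 (r : R) : 1 <= r -> clamp r = clamp 1.
Proof. by move=> r1; apply: val_inj; rewrite /clamp/= minxx min_l. Qed.

Lemma val_continuous : continuous (val : unit_itv -> R).
Proof. exact: initial_continuous. Qed.

Lemma clamp_continuous : continuous clamp.
Proof.
apply: continuous_comp_initial => r /=.
apply: continuous_max; first exact: cvg_cst.
by apply: continuous_min; [exact: cvg_cst | exact: cvg_id].
Qed.

Lemma clamp_neq : clamp 0 != clamp 1.
Proof.
by apply/eqP => /(congr1 val); rewrite !val_clamp// => /esym/eqP; rewrite oner_eq0.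
Qed.

HB.instance Definition _ := isBiPointed.Build unit_itv clamp_neq.

End UnitInterval.

Section PathHomotopy.
Variables (R : realType) (T : topologicalType).
Local Notation I := (unit_itv R).
Implicit Types (x y z w : T) (f g h : I -> T).

(* Homotopy relative to the endpoints, for paths from x to y. *)
Definition path_homotopic x y f g : Prop :=
  exists H : I * I -> T,
    [/\ continuous H,
        forall t, H (zero, t) = f t,
        forall t, H (one, t) = g t,
        forall s, H (s, zero) = x &
        forall s, H (s, one) = y].

Lemma zeroE : zero = clamp 0 :> I. Proof. by []. Qed.

Lemma oneE : one = clamp 1 :> I. Proof. by []. Qed.

Lemma mul2V : 2 * 2^-1 = 1 :> R. Proof. by rewrite mulfV// pnatr_eq0. Qed.

Lemma clamp_comp_continuous (X : topologicalType) (u : X -> R) :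
  continuous u -> continuous (fun a => clamp (u a)).
Proof. by move=> cu a; apply: continuous_comp; [exact: cu | exact: clamp_continuous]. Qed.

Lemma comp_cts (X Y : topologicalType) (F : Y -> T) (u : X -> Y) :
  continuous F -> continuous u -> continuous (fun a => F (u a)).
Proof. by move=> cF cu a; apply: continuous_comp; [exact: cu | exact: cF]. Qed.

Lemma comp_pair_continuous (X Y Z : topologicalType) (F : Y * Z -> T)
    (u : X -> Y) (v : X -> Z) :
  continuous F -> continuous u -> continuous v ->
  continuous (fun a => F (u a, v a)).
Proof.
move=> cF cu cv a.
apply: (@continuous_comp _ _ _ (fun a => (u a, v a)) F); last exact: cF.
by apply: cvg_pair; [exact: cu | exact: cv].
Qed.

Lemma val_fst_continuous : continuous (fun st : I * I => val st.1).
Proof. by move=> a; apply: continuous_comp; [exact: cvg_fst | exact: val_continuous]. Qed.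

Lemma val_snd_continuous : continuous (fun st : I * I => val st.2).
Proof. by move=> a; apply: continuous_comp; [exact: cvg_snd | exact: val_continuous]. Qed.

Section RealContinuity.
Variables (X : topologicalType) (u v : X -> R).
Hypotheses (cu : continuous u) (cv : continuous v).

Lemma add_cts : continuous (fun a => u a + v a).
Proof. by move=> a; apply: cvgD; [exact: cu | exact: cv]. Qed.

Lemma mul_cts : continuous (fun a => u a * v a).
Proof. by move=> a; apply: cvgM; [exact: cu | exact: cv]. Qed.

Lemma min_cts : continuous (fun a => Num.min (u a) (v a)).
Proof. by move=> a; apply: continuous_min; [exact: cu | exact: cv]. Qed.

Lemma addc_cts (c : R) : continuous (fun a => u a + c).
Proof. by move=> a; apply: cvgD; [exact: cu | exact: cvg_cst]. Qed.

Lemma mulc_cts (c : R) : continuous (fun a => c * u a).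
Proof. by move=> a; apply: cvgM; [exact: cvg_cst | exact: cu]. Qed.

Lemma subc_cts (c : R) : continuous (fun a => c - u a).
Proof. by move=> a; apply: cvgB; [exact: cvg_cst | exact: cu]. Qed.

End RealContinuity.

Lemma double_continuous (X : topologicalType) (u : X -> R) :
  continuous u -> continuous (fun a => 2 * u a).
Proof. by move=> cu; exact: mulc_cts. Qed.

Lemma doubleB1_continuous (X : topologicalType) (u : X -> R) :
  continuous u -> continuous (fun a => 2 * u a - 1).
Proof. by move=> cu; apply: addc_cts; exact: mulc_cts. Qed.

Lemma path_homotopic_refl x y f :
  continuous f -> f zero = x -> f one = y -> path_homotopic x y f f.
Proof.
move=> cf f0 f1; exists (fun st => f st.2); split => // a.
by apply: continuous_comp; [exact: cvg_snd | exact: cf].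
Qed.

Definition unit_itv_opp (t : I) : I := clamp (1 - val t).

Lemma unit_itv_opp_continuous : continuous unit_itv_opp.
Proof.
by apply: clamp_comp_continuous; apply: subc_cts; exact: val_continuous.
Qed.

Lemma unit_itv_oppK : involutive unit_itv_opp.
Proof.
move=> t; rewrite /unit_itv_opp -[RHS]clampK; congr clamp.
have t0 := unit_itv_ge0 t; have t1 := unit_itv_le1 t.
by rewrite val_clamp; lra.
Qed.

Lemma unit_itv_opp0 : unit_itv_opp zero = one.
Proof. by rewrite /unit_itv_opp zeroE val_clamp// subr0. Qed.

Lemma unit_itv_opp1 : unit_itv_opp one = zero.
Proof. by rewrite -unit_itv_opp0 unit_itv_oppK. Qed.

Lemma path_homotopic_sym x y f g :
  path_homotopic x y f g -> path_homotopic x y g f.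
Proof.
case=> H [cH H0 H1 Hx Hy]; exists (fun st => H (unit_itv_opp st.1, st.2)); split.
- apply: comp_pair_continuous => // a; last exact: cvg_snd.
  by apply: continuous_comp; [exact: cvg_fst | exact: unit_itv_opp_continuous].
- by move=> t; rewrite /= unit_itv_opp0.
- by move=> t; rewrite /= unit_itv_opp1.
- by move=> s; exact: Hx.
- by move=> s; exact: Hy.
Qed.

Lemma path_homotopic_trans x y f g h :
  path_homotopic x y f g -> path_homotopic x y g h -> path_homotopic x y f h.
Proof.
move=> [H [cH H0 H1 Hx Hy]] [K [cK K0 K1 Kx Ky]].
exists (fun st => if val st.1 <= 2^-1 then H (clamp (2 * val st.1), st.2)
                  else K (clamp (2 * val st.1 - 1), st.2)); split.
- apply: continuous_if_le.
  + exact: val_fst_continuous.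
  + apply: comp_pair_continuous => //; last by move=> a; exact: cvg_snd.
    by apply: clamp_comp_continuous; apply: double_continuous; exact: val_fst_continuous.
  + apply: comp_pair_continuous => //; last by move=> a; exact: cvg_snd.
    by apply: clamp_comp_continuous; apply: doubleB1_continuous; exact: val_fst_continuous.
  + by move=> [s t] /= ->; rewrite mul2V subrr -oneE -zeroE H1 K0.
- by move=> t; cbn [fst snd]; rewrite zeroE val_clamp// ifT ?mulr0 -?zeroE// invr_ge0.
- move=> t; cbn [fst snd]; rewrite oneE val_clamp// ifF; last by lra.
  by rewrite (_ : 2 * 1 - 1 = 1) -?oneE//; lra.
- by move=> s /=; case: ifP.
- by move=> s /=; case: ifP.
Qed.

Lemma path_homotopic_reparam x y f (phi psi : I -> I) :
  continuous f -> continuous phi -> continuous psi ->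
  phi zero = psi zero -> phi one = psi one ->
  f (phi zero) = x -> f (phi one) = y ->
  path_homotopic x y (f \o phi) (f \o psi).
Proof.
move=> cf cphi cpsi e0 e1 f0 f1.
exists (fun st => f (clamp ((1 - val st.1) * val (phi st.2) +
                            val st.1 * val (psi st.2)))); split.
- apply: (comp_cts cf).
  apply: clamp_comp_continuous.
  have cv (u : I -> I) : continuous u -> continuous (fun st : I * I => val (u st.2)).
    move=> cu a; apply: (@continuous_comp _ _ _ (fun st => u st.2) val).
      by apply: continuous_comp; [exact: cvg_snd | exact: cu].
    exact: val_continuous.
  apply: add_cts; apply: mul_cts; try exact: cv; last exact: val_fst_continuous.
  by apply: subc_cts; exact: val_fst_continuous.
- by move=> t; rewrite zeroE val_clamp// subr0 mul1r mul0r addr0 clampK.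
- by move=> t; rewrite oneE val_clamp// subrr mul0r mul1r add0r clampK.
- by move=> s; rewrite /= -e0 -mulrDl subrK mul1r clampK.
- by move=> s; rewrite /= -e1 -mulrDl subrK mul1r clampK.
Qed.

Definition concat f g : I -> T := fun t =>
  if val t <= 2^-1 then f (clamp (2 * val t)) else g (clamp (2 * val t - 1)).

Lemma concat_continuous f g :
  continuous f -> continuous g -> f one = g zero -> continuous (concat f g).
Proof.
move=> cf cg fg; apply: continuous_if_le.
- exact: val_continuous.
- apply: (comp_cts cf).
  by apply: clamp_comp_continuous; apply: double_continuous; exact: val_continuous.
- apply: (comp_cts cg).
  by apply: clamp_comp_continuous; apply: doubleB1_continuous; exact: val_continuous.
- by move=> t ->; rewrite mul2V subrr -oneE -zeroE.
Qed.

Lemma concat0 f g : concat f g zero = f zero.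
Proof. by rewrite /concat zeroE val_clamp// ifT ?mulr0// invr_ge0. Qed.

Lemma concat1 f g : concat f g one = g one.
Proof.
rewrite /concat oneE val_clamp// ifF; last by lra.
by rewrite (_ : 2 * 1 - 1 = 1) -?oneE//; lra.
Qed.

Lemma path_homotopic_concat x y z f f' g g' :
  path_homotopic x y f f' -> path_homotopic y z g g' ->
  path_homotopic x z (concat f g) (concat f' g').
Proof.
move=> [H [cH H0 H1 Hx Hy]] [K [cK K0 K1 Kx Ky]].
exists (fun st => concat (fun t => H (st.1, t)) (fun t => K (st.1, t)) st.2); split.
- apply: continuous_if_le.
  + exact: val_snd_continuous.
  + apply: comp_pair_continuous => //; first by move=> a; exact: cvg_fst.
    by apply: clamp_comp_continuous; apply: double_continuous; exact: val_snd_continuous.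
  + apply: comp_pair_continuous => //; first by move=> a; exact: cvg_fst.
    by apply: clamp_comp_continuous; apply: doubleB1_continuous; exact: val_snd_continuous.
  + by move=> [s t] /= ->; rewrite mul2V subrr -oneE -zeroE Hy Kx.
- by move=> t; rewrite /concat /=; case: ifP.
- by move=> t; rewrite /concat /=; case: ifP.
- by move=> s; rewrite concat0.
- by move=> s; rewrite concat1.
Qed.

Lemma path_homotopic_opp x y f g : path_homotopic x y f g ->
  path_homotopic y x (f \o unit_itv_opp) (g \o unit_itv_opp).
Proof.
case=> H [cH H0 H1 Hx Hy]; exists (fun st => H (st.1, unit_itv_opp st.2)); split.
- apply: comp_pair_continuous => // a; first exact: cvg_fst.
  by apply: continuous_comp; [exact: cvg_snd | exact: unit_itv_opp_continuous].
- by move=> t; exact: H0.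
- by move=> t; exact: H1.
- by move=> s; rewrite /= unit_itv_opp0.
- by move=> s; rewrite /= unit_itv_opp1.
Qed.

Lemma path_homotopic_concatA x y z w f g h :
  continuous f -> continuous g -> continuous h ->
  f zero = x -> f one = y -> g zero = y -> g one = z -> h zero = z -> h one = w ->
  path_homotopic x w (concat f (concat g h)) (concat (concat f g) h).
Proof.
move=> cf cg ch f0 f1 g0 g1 h0 h1.
pose phi (t : I) : I :=
  clamp (Num.min (2 * val t) (Num.min (val t + 4^-1) ((val t + 1) * 2^-1))).
have cphi : continuous phi.
  apply: clamp_comp_continuous.
  apply: min_cts; first by apply: double_continuous; exact: val_continuous.
  apply: min_cts; first by apply: addc_cts; exact: val_continuous.
  apply: mul_cts; first by apply: addc_cts; exact: val_continuous.
  exact: cst_continuous.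
have phi0 : phi zero = zero.
  rewrite /phi zeroE val_clamp//; congr clamp.
  by rewrite mulr0 min_l// le_min; apply/andP; split; lra.
have phi1 : phi one = one.
  rewrite /phi oneE val_clamp//; congr clamp.
  rewrite (_ : (1 + 1) / 2 = 1); last by lra.
  by rewrite (@min_r _ _ (1 + 4^-1)) ?min_r//; lra.
have -> : concat (concat f g) h = concat f (concat g h) \o phi.
  apply/funext => t; rewrite /concat; cbn [comp].
  have t0 := unit_itv_ge0 t; have t1 := unit_itv_le1 t.
  have [t2|t2] := leP (val t) 2^-1.
    rewrite [val (clamp (2 * val t))]val_clamp; [|lra|lra].
    have [t4|t4] := leP (2 * val t) 2^-1.
      rewrite (_ : phi t = clamp (2 * val t)).
        by rewrite [val (clamp _)]val_clamp ?t4//; lra.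
      by congr clamp; rewrite min_l// le_min; apply/andP; split; lra.
    rewrite (_ : phi t = clamp (val t + 4^-1)).
      rewrite [val (clamp (_ + _))]val_clamp; [|lra|lra].
      rewrite ifF; last by lra.
      rewrite [val (clamp _)]val_clamp; [|lra|lra].
      by rewrite ifT; [congr (g (clamp _)); lra | lra].
    by congr clamp; rewrite (@min_l _ _ (val t + 4^-1)) ?min_r//; lra.
  rewrite (_ : phi t = clamp ((val t + 1) * 2^-1)).
    rewrite [val (clamp (_ * 2^-1))]val_clamp; [|lra|lra].
    rewrite ifF; last by lra.
    rewrite [val (clamp _)]val_clamp; [|lra|lra].
    by rewrite ifF; [congr (h (clamp _)); lra | lra].
  by congr clamp; rewrite (@min_r _ _ (val t + 4^-1)) ?min_r//; lra.
rewrite -[X in path_homotopic _ _ X]/(concat f (concat g h) \o idfun).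
apply: path_homotopic_reparam => //.
- apply: concat_continuous => //; last by rewrite concat0 f1.
  by apply: concat_continuous => //; rewrite g1.
- by move=> a; exact: cvg_id.
- by rewrite concat0.
- by rewrite !concat1.
Qed.

Lemma path_homotopic_concat1p x y f :
  continuous f -> f zero = x -> f one = y ->
  path_homotopic x y (concat (cst x) f) f.
Proof.
move=> cf f0 f1; pose phi (t : I) : I := clamp (2 * val t - 1).
have -> : concat (cst x) f = f \o phi.
  apply/funext => t; rewrite /concat; cbn [comp]; case: ifPn => // t2.
  by rewrite /cst /phi clamp_le0 -?zeroE ?f0//; lra.
rewrite -[X in path_homotopic _ _ _ X]/(f \o idfun).
have phi0 : phi zero = zero.
  by rewrite /phi zeroE val_clamp// clamp_le0//; lra.
have phi1 : phi one = one.
  by rewrite /phi oneE val_clamp// clamp_ge1//; lra.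
apply: path_homotopic_reparam; rewrite ?phi0 ?phi1//.
- by apply: clamp_comp_continuous; apply: doubleB1_continuous; exact: val_continuous.
- by move=> a; exact: cvg_id.
Qed.

Lemma path_homotopic_concatp1 x y f :
  continuous f -> f zero = x -> f one = y ->
  path_homotopic x y (concat f (cst y)) f.
Proof.
move=> cf f0 f1; pose phi (t : I) : I := clamp (2 * val t).
have -> : concat f (cst y) = f \o phi.
  apply/funext => t; rewrite /concat; cbn [comp]; case: ifPn => // t2.
  by rewrite /cst /phi clamp_ge1 -?oneE ?f1//; lra.
rewrite -[X in path_homotopic _ _ _ X]/(f \o idfun).
have phi0 : phi zero = zero by rewrite /phi zeroE val_clamp// mulr0.
have phi1 : phi one = one.
  by rewrite /phi oneE val_clamp// clamp_ge1//; lra.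
apply: path_homotopic_reparam; rewrite ?phi0 ?phi1//.
- by apply: clamp_comp_continuous; apply: double_continuous; exact: val_continuous.
- by move=> a; exact: cvg_id.
Qed.

Lemma path_homotopic_concatpV x y f :
  continuous f -> f zero = x -> f one = y ->
  path_homotopic x x (concat f (f \o unit_itv_opp)) (cst x).
Proof.
move=> cf f0 f1.
pose phi (t : I) : I := clamp (Num.min (2 * val t) (1 - (2 * val t - 1))).
have -> : concat f (f \o unit_itv_opp) = f \o phi.
  apply/funext => t; rewrite /concat; cbn [comp].
  have t0 := unit_itv_ge0 t; have t1 := unit_itv_le1 t.
  case: ifPn => t2; first by rewrite /phi min_l//; lra.
  by rewrite /phi /unit_itv_opp val_clamp ?min_r//; lra.
have -> : cst x = f \o cst zero :> (I -> T) by apply/funext => t; rewrite /= f0.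
have phi0 : phi zero = zero.
  by rewrite /phi zeroE val_clamp// mulr0 min_l//; lra.
have phi1 : phi one = zero.
  by rewrite /phi oneE val_clamp// clamp_le0//; rewrite ge_min; apply/orP; right; lra.
apply: path_homotopic_reparam; rewrite ?phi0 ?phi1//.
- apply: clamp_comp_continuous; apply: min_cts.
    by apply: double_continuous; exact: val_continuous.
  by apply: subc_cts; apply: doubleB1_continuous; exact: val_continuous.
- exact: cst_continuous.
Qed.

End PathHomotopy.

Section FundamentalGroup.
Variables (R : realType) (T : topologicalType) (x : T).
Local Notation I := (unit_itv R).

Definition loop : Type := {path I from x to x in T}.
HB.instance Definition _ := Choice.on loop.

Implicit Types p q r : loop.

Lemma loop_cts p : continuous p. Proof. exact: cts_fun. Qed.

Definition loop_homotopic p q : bool := `[< path_homotopic x x p q >].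

Lemma loop_homotopic_refl : reflexive loop_homotopic.
Proof.
move=> p; apply/asboolP.
by apply: path_homotopic_refl; rewrite ?path_zero ?path_one//; exact: loop_cts.
Qed.

Lemma loop_homotopic_sym : symmetric loop_homotopic.
Proof. by move=> p q; apply/asboolP/asboolP; exact: path_homotopic_sym. Qed.

Lemma loop_homotopic_trans : transitive loop_homotopic.
Proof.
move=> q p r /asboolP pq /asboolP qr; apply/asboolP.
exact: path_homotopic_trans pq qr.
Qed.

Definition loop_homotopy_equiv : equiv_rel loop :=
  EquivRel loop_homotopic loop_homotopic_refl loop_homotopic_sym
    loop_homotopic_trans.

Lemma concat_loop_cts p q : continuous (concat p q).
Proof.
by apply: concat_continuous; rewrite ?path_zero ?path_one//; exact: loop_cts.
Qed.

Lemma concat_loop0 p q : concat p q zero = x.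
Proof. by rewrite concat0 path_zero. Qed.

Lemma concat_loop1 p q : concat p q one = x.
Proof. by rewrite concat1 path_one. Qed.

Definition loop_mul p q : loop :=
  mk_path (@concat_loop_cts p q) (concat_loop0 p q) (concat_loop1 p q).

Lemma loop_mulE p q : loop_mul p q = concat p q :> (I -> T).
Proof. by []. Qed.

Lemma opp_loop_cts p : continuous (p \o @unit_itv_opp R).
Proof. by apply: comp_cts; [exact: loop_cts | exact: unit_itv_opp_continuous]. Qed.

Lemma opp_loop0 p : (p \o @unit_itv_opp R) zero = x.
Proof. by rewrite /= unit_itv_opp0 path_one. Qed.

Lemma opp_loop1 p : (p \o @unit_itv_opp R) one = x.
Proof. by rewrite /= unit_itv_opp1 path_zero. Qed.

Definition loop_inv p : loop :=
  mk_path (@opp_loop_cts p) (opp_loop0 p) (opp_loop1 p).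

Lemma loop_invE p : loop_inv p = p \o @unit_itv_opp R :> (I -> T).
Proof. by []. Qed.

Definition loop_one : loop := cst x.

Lemma loop_oneE : loop_one = cst x :> (I -> T). Proof. by []. Qed.

(* The fundamental group of T at x, for loops parametrized by the unit interval
   of R. *)
Definition pi1 : Type := {eq_quot loop_homotopy_equiv}.
HB.instance Definition _ := Choice.on pi1.
HB.instance Definition _ := EqQuotient.on pi1.

Definition pi1_one : pi1 := \pi_pi1 loop_one.
Definition pi1_inv (a : pi1) : pi1 := \pi_pi1 (loop_inv (repr a)).
Definition pi1_mul (a b : pi1) : pi1 := \pi_pi1 (loop_mul (repr a) (repr b)).

Lemma pi1_eqP p q : path_homotopic x x p q <-> \pi_pi1 p = \pi_pi1 q.
Proof. by split => [pq|/eqmodP/asboolP//]; apply/eqmodP/asboolP. Qed.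

Lemma repr_pi1 p : path_homotopic x x (repr (\pi_pi1 p)) p.
Proof. by apply/pi1_eqP; rewrite reprK. Qed.

Lemma pi1_mulE p q : pi1_mul (\pi_pi1 p) (\pi_pi1 q) = \pi_pi1 (loop_mul p q).
Proof. by apply/pi1_eqP; apply: path_homotopic_concat; exact: repr_pi1. Qed.

Lemma pi1_invE p : pi1_inv (\pi_pi1 p) = \pi_pi1 (loop_inv p).
Proof. by apply/pi1_eqP; apply: path_homotopic_opp; exact: repr_pi1. Qed.

Lemma pi1_mulA : associative pi1_mul.
Proof.
elim/quotW => p; elim/quotW => q; elim/quotW => r.
rewrite (pi1_mulE q r) (pi1_mulE p (loop_mul q r)).
rewrite (pi1_mulE p q) (pi1_mulE (loop_mul p q) r).
apply/pi1_eqP; rewrite !loop_mulE; apply: path_homotopic_concatA;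
  by rewrite ?path_zero ?path_one//; exact: loop_cts.
Qed.

Lemma pi1_mul1g : left_id pi1_one pi1_mul.
Proof.
elim/quotW => p; rewrite pi1_mulE; apply/pi1_eqP; rewrite loop_mulE loop_oneE.
by apply: path_homotopic_concat1p; rewrite ?path_zero ?path_one//; exact: loop_cts.
Qed.

Lemma pi1_mulg1 : right_id pi1_one pi1_mul.
Proof.
elim/quotW => p; rewrite pi1_mulE; apply/pi1_eqP; rewrite loop_mulE loop_oneE.
by apply: path_homotopic_concatp1; rewrite ?path_zero ?path_one//; exact: loop_cts.
Qed.

Lemma pi1_mulgV : right_inverse pi1_one pi1_inv pi1_mul.
Proof.
elim/quotW => p; rewrite pi1_invE (pi1_mulE p (loop_inv p)); apply/pi1_eqP.
rewrite loop_mulE loop_invE loop_oneE.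
by apply: (path_homotopic_concatpV (y := x)); rewrite ?path_zero ?path_one//; exact: loop_cts.
Qed.

Lemma pi1_invK : involutive pi1_inv.
Proof.
elim/quotW => p; rewrite (pi1_invE p) (pi1_invE (loop_inv p)).
have -> // : loop_inv (loop_inv p) = p.
by apply/path_eqP => t; rewrite !loop_invE /= unit_itv_oppK.
Qed.

Lemma pi1_mulVg : left_inverse pi1_one pi1_inv pi1_mul.
Proof. by move=> a; rewrite -{2}(pi1_invK a) pi1_mulgV. Qed.

HB.instance Definition _ :=
  isGroup.Build pi1 pi1_mulA pi1_mul1g pi1_mulg1 pi1_mulVg pi1_mulgV.

End FundamentalGroup.

Definition trivial_group (G : groupType) : Prop := forall a : G, a = 1%g.

Definition isomorphic_groups (G H : groupType) : Prop :=
  exists f : {multiplicative G -> H}, bijective f.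

Section Grassmannian.
Variables (K : numFieldType) (k n : nat).

Definition frame_rows (M : 'M[K]_(k, n)) : seq 'rV[K]_n :=
  [seq row i M | i : 'I_k].

(* The noncompact Stiefel manifold, as a subspace of K^(k x n), where K has the
   topology of its norm. *)
Definition frame : Type := [set M : 'M[K]_(k, n) | free (frame_rows M)].
HB.instance Definition _ := Topological.on frame.

Definition Gr : Type := {V : {vspace 'rV[K]_n} | \dim V == k}.
HB.instance Definition _ := SubType.on Gr.

Lemma frame_span_subproof (F : frame) : \dim <<frame_rows (val F)>>%VS == k.
Proof.
have freeF : free (frame_rows (val F)) := set_valP F.
by rewrite (eqP freeF) size_map size_enum_ord.
Qed.

Definition frame_span (F : frame) : Gr :=
  exist (fun V : {vspace 'rV[K]_n} => \dim V == k) _ (frame_span_subproof F).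

Lemma frame_span_surj (V : Gr) : exists F : frame, frame_span F = V.
Proof.
case: V => V dimV_k; have /eqP dimV := dimV_k.
pose M : 'M[K]_(k, n) := \matrix_(i < k) (vbasis V)`_i.
have rowsM : frame_rows M = vbasis V.
  apply: (@eq_from_nth _ 0).
    by rewrite size_map size_enum_ord size_tuple dimV.
  move=> i; rewrite size_map size_enum_ord => ik.
  by rewrite (nth_map (Ordinal ik)) ?size_enum_ord// rowK nth_enum_ord.
have freeM : M \in [set M : 'M[K]_(k, n) | free (frame_rows M)].
  by rewrite inE /= rowsM (basis_free (vbasisP V)).
exists (exist (fun M => M \in [set M : 'M[K]_(k, n) | free (frame_rows M)]) M freeM).
by apply: val_inj; rewrite /= rowsM (span_basis (vbasisP V)).
Qed.

Definition Gr_frame (V : Gr) : frame := projT1 (cid (frame_span_surj V)).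

Lemma Gr_frameK : cancel Gr_frame frame_span.
Proof. by move=> V; rewrite /Gr_frame; case: cid. Qed.

(* The topology of Gr is the quotient topology for frame_span; the section
   Gr_frame only witnesses that frame_span is surjective. *)
HB.instance Definition _ := isQuotient.Build frame Gr Gr_frameK.
HB.instance Definition _ := Topological.copy Gr (quotient_topology Gr).

Lemma pi_GrE (F : frame) : \pi_Gr F = frame_span F.
Proof. by rewrite pi.unlock. Qed.

Lemma Gr_openE (U : set Gr) : open U = open (frame_span @^-1` U).
Proof.
by have -> : frame_span = \pi_Gr by apply/funext => F; rewrite pi_GrE.
Qed.

End Grassmannian.

Definition configuration (h : nat) (M : topologicalType) : Type :=
  [set x : {ptws 'I_h -> M} | injective x].
HB.instance Definition _ h M := Topological.on (configuration h M).

Definition pure_braid_group (R : realType) (h : nat) (M : topologicalType)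
    (x : configuration h M) : groupType :=
  pi1 R x.

(* Gr inherits the topology of R[i] given by its norm as a numFieldType. *)
Definition CP1 (R : realType) : topologicalType := Gr R[i] 1 2.

Definition configuration_dim (R : realType) (h k n i : nat) : Type :=
  [set H : {ptws 'I_h -> Gr R[i] k n} |
     injective H /\ \dim (\sum_(a < h) val (H a))%VS = i].
HB.instance Definition _ R h k n i :=
  Topological.on (configuration_dim R h k n i).

(* Main.v *)
Require Import Defs.
From HB Require Import structures.
From mathcomp Require Import all_boot all_order all_algebra generic_quotient.
From mathcomp Require Import all_classical all_reals topology normedtype homotopy.
From mathcomp Require Import complex zify ring lra.

(** Write a configuration of h subspaces of dimension k in C^n as the row spans
    of the h blocks of an (h k) x n matrix M.  The configurations whose sum has
    the largest possible dimension min(n, h k) come from the set [conf_frames]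
    of matrices such that M has rank min(n, h k), every block has rank k, and
    two different blocks together have rank at least k + 1.  The first condition
    fails on a cone of complex codimension |n - h k| + 1, the second on one of
    codimension n - k + 1, the third on one of codimension k (n - k) inside the
    matrices that satisfy the second.  If n <> h k and n <> 2 all of these are
    at least 2.  Hence [conf_frames] is a vector space minus a set of real
    codimension at least 4, which is simply connected; and since the fibres
    GL_k(C)^h of its projection to the configurations are connected, the
    configuration space is simply connected as well.

    The notion of dimension can be avoided.  Its substitute is [pencil_rich]: for
    each x in the set S there is a w for which the whole complex plane spanned by
    x and w lies in S, except possibly 0; and for fixed x the set of all such w is
    generic, in the sense that every complex line through one of them lies in
    this set up to finitely many points ([line_cofinite]).  For a single rank
    condition the existence of w is seen on a shift matrix
    ([rank_pencil_exists]), and the genericity is elimination theory: the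
    exceptional parameters on a line are roots of a resultant
    ([rank_pencil_cofinite]).  Both properties survive finite intersections.

    In an open pencil-rich set S every loop is null-homotopic
    ([rich_null_homotopic]).  Subdivide the loop so finely that consecutive
    division points x, y lie in a convex part of S.  There is one w such that all
    division points are good for it, that is, span with it a complex plane in S.
    Between x and y replace the loop by x + c(t) (y - x), where c is a curve in C
    from 0 to 1, close to the real segment, that dodges the finitely many c for
    which x + c (y - x) is not good.  The segment from x to y itself could meet
    such values; the second real dimension of C makes room for c.  All points of
    the new loop are good, so the cone over it with apex w stays in S.

    Loops of configurations lift to [conf_frames] through the local sections
    M |-> (M Q)^-1 M of the Grassmannian ([Gr_path_lift]).  The lifted path ends
    in the fibre in which it starts, where an arc as above closes it up
    ([conf_fiber_path]); so loops of configurations are null-homotopic too.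

    If n = 2, then k = 1, and two different lines already span C^2, so that the
    two spaces of configurations in the statement coincide.  The isomorphism
    between the fundamental groups at two arbitrary base points then only needs
    that this space is path connected ([conf_path_connected]). *)

Set Implicit Arguments.
Unset Strict Implicit.
Unset Printing Implicit Defensive.

Import Order.TTheory GRing.Theory Num.Theory numFieldNormedType.Exports.

Local Open Scope classical_set_scope.
Local Open Scope quotient_scope.
Local Open Scope ring_scope.

(** * Sets that contain almost all of each complex line *)

Lemma fresh_value (T : eqType) (f : nat -> T) (s : seq T) : injective f ->
  exists i, f i \notin s.
Proof.
move=> f_inj; pose t := [seq f i | i <- iota 0 (size s).+1].
have ut : uniq t by rewrite map_inj_uniq ?iota_uniq.
have /allPn[c /mapP[i _ ->] cs] : ~~ all (mem s) t.
  apply/negP => /allP ts; have := uniq_leq_size ut ts.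
  by rewrite size_map size_iota ltnn.
by exists i.
Qed.

Section Cofinitely.
Variable F : numFieldType.

Definition cofinitely (P : F -> Prop) : Prop :=
  exists s : seq F, forall c, c \notin s -> P c.

Lemma cofinitely_mono (P Q : F -> Prop) :
  (forall c, P c -> Q c) -> cofinitely P -> cofinitely Q.
Proof. by move=> PQ [s sP]; exists s => c /sP /PQ. Qed.

Lemma cofinitely_and (P Q : F -> Prop) :
  cofinitely P -> cofinitely Q -> cofinitely (fun c => P c /\ Q c).
Proof.
move=> [s sP] [t tQ]; exists (s ++ t) => c.
by rewrite mem_cat negb_or => /andP[/sP Pc /tQ Qc].
Qed.

Lemma cofinitely_all (T : eqType) (s : seq T) (P : T -> F -> Prop) :
  (forall i, i \in s -> cofinitely (P i)) ->
  cofinitely (fun c => forall i, i \in s -> P i c).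
Proof.
elim: s => [|i s IHs] Ps; first by exists [::].
have Pi := Ps i (mem_head i s).
have {}IHs : cofinitely (fun c => forall j, j \in s -> P j c).
  by apply: IHs => j js; apply: Ps; rewrite in_cons js orbT.
apply: cofinitely_mono (cofinitely_and Pi IHs) => c [Pic Psc] j.
by rewrite in_cons => /orP[/eqP->|/Psc].
Qed.

Lemma cofinitely_ex (P : F -> Prop) : cofinitely P -> exists c, P c.
Proof.
move=> [s sP]; have inj : injective (fun i => i%:R : F).
  by move=> i j /eqP; rewrite eqr_nat => /eqP.
by have [i /sP Pi] := fresh_value s inj; exists i%:R.
Qed.

(** The substitute for a Zariski open set: it needs no polynomials, and two
    nonempty sets of this kind meet. *)
Definition line_cofinite (V : lmodType F) (S : V -> Prop) : Prop :=
  forall x d, S x -> cofinitely (fun c => S (x + c *: d)).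

(** The line through a common point x of the sets treated so far and a point y of
    the next one is almost contained in each of them, so they all meet on it. *)
Lemma line_cofinite_common (V : lmodType F) (T : eqType) (s : seq T)
    (S : T -> V -> Prop) :
  (forall i, i \in s -> exists x, S i x) ->
  (forall i, i \in s -> line_cofinite (S i)) ->
  exists x, forall i, i \in s -> S i x.
Proof.
elim: s => [|i s IHs] nonempty cof; first by exists 0.
have [||x Sx] := IHs.
- by move=> j js; apply: nonempty; rewrite in_cons js orbT.
- by move=> j js; apply: cof; rewrite in_cons js orbT.
have [y Siy] := nonempty i (mem_head i s).
have Px : cofinitely (fun c => forall j, j \in s -> S j (x + c *: (y - x))).
  apply: cofinitely_all => j js; apply: cof; last exact: Sx.
  by rewrite in_cons js orbT.
have [t Py] := cof i (mem_head i s) y (x - y) Siy.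
have Py' : cofinitely (fun c => S i (x + c *: (y - x))).
  exists [seq 1 - c | c <- t] => c ct.
  have -> : x + c *: (y - x) = y + (1 - c) *: (x - y).
    by rewrite scalerBl scale1r -scalerN opprB addrA [y + (x - y)]addrC subrK.
  apply: Py; apply: contra ct => ct; apply/mapP; exists (1 - c) => //.
  by rewrite opprB addrCA subrr addr0.
have [c [Sxc Sic]] := cofinitely_ex (cofinitely_and Px Py').
exists (x + c *: (y - x)) => j.
by rewrite in_cons => /orP[/eqP->|/Sxc].
Qed.

End Cofinitely.

Section Pencils.
Variables (F : numFieldType) (V : lmodType F).

Definition pencil_in (S : V -> Prop) (x w : V) : Prop :=
  forall a b : F, (a != 0) || (b != 0) -> S (a *: x + b *: w).

Lemma pencil_in_sym S x w : pencil_in S x w -> pencil_in S w x.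
Proof. by move=> Sxw a b ab; rewrite addrC; apply: Sxw; rewrite orbC. Qed.

(** A model for the complements of algebraic cones of complex codimension at least
    2: a generic complex plane through x meets such a cone only in 0. *)
Definition pencil_rich (S : V -> Prop) : Prop :=
  (forall x, S x -> exists w, pencil_in S x w) /\
  (forall x, line_cofinite (pencil_in S x)).

Lemma pencil_rich_all (I : finType) (S : I -> V -> Prop) :
  (forall i, pencil_rich (S i)) -> pencil_rich (fun x => forall i, S i x).
Proof.
move=> richS; split=> [x Sx|x w d Sw].
  have [||w Sw] := @line_cofinite_common F V I (enum I) (fun i => pencil_in (S i) x).
  - by move=> i _; have [ex _] := richS i; exact: ex.
  - by move=> i _; have [_] := richS i; apply.
  by exists w => a b ab i; apply: (Sw i); rewrite ?mem_enum.
have : cofinitely (fun c => forall i, i \in enum I -> pencil_in (S i) x (w + c *: d)).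
  apply: cofinitely_all => i _; have [_ cof] := richS i.
  by apply: cof => a b ab; exact: Sw.
by apply: cofinitely_mono => c Sc a b ab i; apply: Sc; rewrite ?mem_enum.
Qed.

End Pencils.

Section RankCertificates.
Variable F : fieldType.

(** A lower bound on a rank is witnessed by a nonzero determinant; this is how
    rank conditions become polynomial ones. *)
Lemma rank_ge_mul1 m p r (A : 'M[F]_(m, p)) : (r <= \rank A)%N ->
  exists (P : 'M_(r, m)) (Q : 'M_(p, r)), P *m A *m Q = 1%:M.
Proof.
move=> rA; exists (pid_mx r *m invmx (col_ebase A)), (invmx (row_ebase A) *m pid_mx r).
rewrite -[X in _ *m X *m _](mulmx_ebase A) !mulmxA.
rewrite mulmxKV ?col_ebase_unit// mulmxK ?row_ebase_unit//.
have rm := leq_trans rA (rank_leq_row A).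
have rp := leq_trans rA (rank_leq_col A).
by rewrite !mul_pid_mx (minn_idPl rA) (minn_idPr rm) minnn (minn_idPr rp) pid_mx_1.
Qed.

Lemma det_rank_ge m p r (A : 'M[F]_(m, p)) (P : 'M_(r, m)) (Q : 'M_(p, r)) :
  \det (P *m A *m Q) != 0 -> (r <= \rank A)%N.
Proof.
move=> detPAQ; have /mxrank_unit <- : P *m A *m Q \in unitmx.
  by rewrite unitmxE unitfE.
exact: leq_trans (mxrankM_maxl _ _) (mxrankM_maxr _ _).
Qed.

End RankCertificates.

Section Elimination.
Variable F : numClosedFieldType.

Lemma cofinitely_poly (p : {poly F}) : p != 0 -> cofinitely (fun c => p.[c] != 0).
Proof.
move=> p0; have [rs ->] := closed_field_poly_normal p.
exists rs => c crs; rewrite hornerZ mulf_neq0 ?lead_coef_eq0//.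
by rewrite -rootE root_prod_XsubC.
Qed.

(** Evaluation of a polynomial in z whose coefficients are polynomials in c. *)
Definition eval2 (c z : F) : {rmorphism {poly {poly F}} -> F} :=
  horner_eval c \o horner_eval z%:P.

Lemma eval2E c z v : eval2 c z v = (map_poly (horner_eval c) v).[z].
Proof.
have zE : horner_eval c z%:P = z by exact: hornerC.
by rewrite -[in RHS]zE horner_map.
Qed.

Lemma eval2CC c z a : eval2 c z a%:P%:P = a.
Proof. by rewrite /= /horner_eval !hornerC. Qed.

Lemma common_root_resultant (f g : {poly F}) : (f != 0) || (g != 0) ->
  (resultant f g == 0) -> exists2 z, root f z & root g z.
Proof.
move=> fg; rewrite resultant_eq0 => sz.
have /closed_rootP[z] : size (gcdp f g) != 1%N by rewrite neq_ltn sz orbT.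
by rewrite root_gcd => /andP[fz gz]; exists z.
Qed.

Lemma resultant_common_root (f g : {poly F}) z : f != 0 ->
  root f z -> root g z -> resultant f g = 0.
Proof.
move=> f0 fz gz; apply/eqP; rewrite resultant_eq0 ltnNge; apply/negP => sz.
have : root (gcdp f g) z by rewrite root_gcd fz.
by move/root_size_gt1; rewrite gcdp_eq0 (negPf f0)/= => /(_ isT); rewrite ltnNge sz.
Qed.

(** Among the minors of z A + C + c D choose f, monic in z for all c, which is
    possible since A has rank at least r.  At c = 0 the minors have no common
    zero, so some combination v of them does not vanish at the finitely many
    roots of f.  The resultant of f and v in z is then a polynomial in c that is
    nonzero at c = 0, and where it is nonzero f and v have no common root.  The
    role of A as the point at infinity of the pencil is what keeps roots from
    escaping when c varies. *)
Lemma rank_pencil_cofinite m p r (A C D : 'M[F]_(m, p)) : (r <= \rank A)%N ->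
  (forall z, r <= \rank (z *: A + C)%R)%N ->
  cofinitely (fun c => forall z, r <= \rank (z *: A + (C + c *: D))%R)%N.
Proof.
move=> rA rAC.
(* J v: wherever v does not vanish the rank is at least r.  Sums and multiples of
   such v inherit the property. *)
pose J (v : {poly {poly F}}) := forall c z, eval2 c z v != 0 ->
  (r <= \rank (z *: A + (C + c *: D))%R)%N.
pose CC : {rmorphism F -> {poly {poly F}}} := polyC \o polyC.
have eCC c z m' p' (M : 'M[F]_(m', p')) : map_mx (eval2 c z) (map_mx CC M) = M.
  by apply/matrixP => i j; rewrite !mxE eval2CC.
have [P0 [Q0 PAQ0]] := rank_ge_mul1 rA.
(* P0 and Q0 turn A into the identity matrix, hence the minor of z A + C + c D
   that they cut out into the characteristic polynomial of N. *)
pose N : 'M[{poly F}]_r :=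
  - (map_mx polyC (P0 *m C *m Q0) + 'X *: map_mx polyC (P0 *m D *m Q0)).
pose f := char_poly N.
have f_monic : f \is monic by exact: char_poly_monic.
have Jf : J f.
  move=> c z; rewrite /f /char_poly -det_map_mx /char_poly_mx => detN.
  apply: (@det_rank_ge _ _ _ _ _ P0 Q0); apply: contra detN => /eqP <-; apply/eqP.
  congr (\det _); apply/matrixP => i j.
  rewrite !mulmxDr !mulmxDl -!scalemxAr -!scalemxAl PAQ0.
  rewrite !mxE /= -polyCN opprK /horner_eval !(hornerD, hornerMn, hornerX, hornerC).
  by rewrite hornerM hornerX hornerC mulr_natr.
have local_cert z : exists2 v, J v & eval2 0 z v != 0.
  have [P [Q PQ]] := rank_ge_mul1 (rAC z).
  pose T := 'X *: map_mx CC A + (map_mx CC C + 'X%:P *: map_mx CC D).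
  have TE c y : map_mx (eval2 c y) (map_mx CC P *m T *m map_mx CC Q) =
      P *m (y *: A + (C + c *: D)) *m Q.
    rewrite !map_mxM !eCC !map_mxD !map_mxZ !eCC /= /horner_eval.
    by rewrite hornerX !hornerC hornerX.
  exists (\det (map_mx CC P *m T *m map_mx CC Q)).
    by move=> c y; rewrite -det_map_mx TE; exact: det_rank_ge.
  by rewrite -det_map_mx TE scale0r addr0 PQ det1 oner_neq0.
have roots_cert (s : seq F) : exists2 v, J v & forall z, z \in s -> eval2 0 z v != 0.
  elim: s => [|y s [v Jv sv]]; first by exists f.
  have [vy0|vy0] := eqVneq (eval2 0 y v) 0; last first.
    by exists v => // z; rewrite in_cons => /orP[/eqP->|/sv].
  have [g Jg gy] := local_cert y.
  (* Correct v at the new point y by a multiple of g that vanishes on s. *)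
  pose l : {poly {poly F}} := \prod_(a <- s) ('X - a%:P%:P).
  have lE c z : eval2 c z l = \prod_(a <- s) (z - a).
    rewrite rmorph_prod; apply: eq_bigr => a _.
    by rewrite rmorphB /= /horner_eval hornerX !hornerC.
  exists (v + l * g).
    move=> c z; rewrite rmorphD rmorphM.
    have [v0|/Jv//] := eqVneq (eval2 c z v) 0.
    by rewrite v0 add0r mulf_eq0 negb_or => /andP[_ /Jg].
  move=> z; rewrite in_cons rmorphD rmorphM lE.
  have [zs _|zs] := boolP (z \in s).
    rewrite [X in _ + X * _](_ : _ = 0) ?mul0r ?addr0 ?sv//.
    by apply/eqP; rewrite prodf_seq_eq0; apply/hasP; exists z; rewrite ?subrr/=.
  rewrite orbF => /eqP zy; rewrite zy vy0 add0r mulf_neq0//.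
  rewrite prodf_seq_neq0; apply/allP => a /= as_; rewrite subr_eq0.
  by apply: contraNneq zs => ya; rewrite zy ya.
have [rs f00E] := closed_field_poly_normal (map_poly (horner_eval 0) f).
have [v Jv vrs] := roots_cert rs.
(* g and v agree at the roots of f, and g is monic: so the degrees in z do not
   drop at any c, and the resultant commutes with the evaluation at c. *)
pose g := v + f * 'X^(size v).
have f0 : f != 0 by exact: monic_neq0.
have lead_g : lead_coef g = 1.
  rewrite /g lead_coefDr; first by rewrite lead_coef_Mmonic ?monicXn// (monicP f_monic).
  by rewrite size_mulXn// -{1}[size v]addn0 ltn_add2l lt0n size_poly_eq0.
have lead_f : lead_coef f = 1 by exact/monicP.
pose res := resultant f g.
have resE c : res.[c] =
    resultant (map_poly (horner_eval c) f) (map_poly (horner_eval c) g).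
  by rewrite -map_resultant ?lead_f ?lead_g ?rmorph1 ?oner_neq0.
have fc0 c : map_poly (horner_eval c) f != 0.
  by rewrite monic_neq0// monic_map.
have gE c z : eval2 c z f = 0 -> eval2 c z g = eval2 c z v.
  by move=> fz; rewrite /g rmorphD rmorphM fz mul0r addr0.
have res0 : res != 0.
  apply/eqP => res0.
  have /eqP := resE 0; rewrite res0 horner0 eq_sym => /common_root_resultant.
  rewrite fc0 => -[//|z fz gz].
  have zrs : z \in rs.
    by move: fz; rewrite f00E rootZ ?lead_coef_eq0// root_prod_XsubC.
  have /negP := vrs _ zrs; apply.
  by rewrite -gE ?eval2E -?rootE//; apply/eqP; rewrite -rootE.
apply: cofinitely_mono (cofinitely_poly res0) => c resc z.
have [fz|/Jf//] := eqVneq (eval2 c z f) 0.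
apply: Jv; rewrite -gE//; apply: contra resc => gz.
by rewrite resE (@resultant_common_root _ _ z)// rootE -eval2E ?fz ?gz.
Qed.

End Elimination.

Section PencilExistence.
Variable F : fieldType.

Lemma det_mxsub_rank_ge m p r (f : 'I_r -> 'I_m) (g : 'I_r -> 'I_p) (A : 'M[F]_(m, p)) :
  \det (mxsub f g A) != 0 -> (r <= \rank A)%N.
Proof.
have -> : mxsub f g A = rowsub f 1%:M *m A *m colsub g 1%:M.
  by rewrite mul_rowsub_mx mul1mx mulmx_colsub mulmx1 -mxsubcr.
exact: det_rank_ge.
Qed.

(** The top left r x (r + 1) block is bidiagonal, with a on the diagonal and b
    above it.  If b <> 0, deleting its first column leaves a triangular matrix
    with b on the diagonal; if b = 0, deleting the last one leaves the scalar
    matrix a. *)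
Lemma shift_pencil_rank m p r q (a b : F) : (r <= m)%N -> (r < p)%N -> (r <= q)%N ->
  (a != 0) || (b != 0) ->
  (r <= \rank (a *: pid_mx q + b *: (\matrix_(i, j) (j == i.+1 :> nat)%:R) : 'M_(m, p))%R)%N.
Proof.
move=> rm rp rq ab; pose f (i : 'I_r) : 'I_m := widen_ord rm i.
have [b0|b0] := eqVneq b 0; last first.
  pose g (i : 'I_r) : 'I_p := Ordinal (leq_ltn_trans (ltn_ord i) rp).
  apply: (@det_mxsub_rank_ge _ _ _ f g); rewrite det_trig.
    apply/prodf_neq0 => i _; rewrite !mxE /= eqxx.
    by rewrite (ltn_eqF (ltnSn i)) mulr0 add0r mulr1.
  apply/is_trig_mxP => i j ij; rewrite !mxE /= eqSS.
  by rewrite (gtn_eqF ij) (ltn_eqF (leqW ij)) !mulr0 addr0.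
move: ab; rewrite b0 eqxx orbF => a0.
pose g (i : 'I_r) : 'I_p := widen_ord (ltnW rp) i.
apply: (@det_mxsub_rank_ge _ _ _ f g); rewrite scale0r addr0.
suff -> : mxsub f g (a *: pid_mx q) = a%:M.
  by rewrite det_scalar expf_neq0.
apply/matrixP => i j; rewrite !mxE /= (leq_trans (ltn_ord i) rq) andbT -val_eqE.
by rewrite mulr_natr.
Qed.

(** In the bases of a Gaussian elimination A is a partial identity matrix. *)
Lemma rank_pencil_exists m p r (A : 'M[F]_(m, p)) :
  (r <= \rank A)%N -> (r < m)%N || (r < p)%N ->
  exists C, forall a b, (a != 0) || (b != 0) -> (r <= \rank (a *: A + b *: C)%R)%N.
Proof.
wlog rp : m p A / (r < p)%N.
  move=> H rA /orP[rm|rp]; last by apply: H; rewrite ?rp ?orbT.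
  have [|||C HC] := H _ _ A^T; rewrite ?mxrank_tr ?rm ?orbT//.
  exists C^T => a b ab; rewrite -mxrank_tr linearD !linearZ /= trmxK.
  exact: HC.
move=> rA _; exists (col_ebase A *m (\matrix_(i, j) (j == i.+1 :> nat)%:R) *m row_ebase A).
set S := \matrix_(i, j) _; move=> a b ab.
have -> : a *: A + b *: (col_ebase A *m S *m row_ebase A) =
    col_ebase A *m (a *: pid_mx (\rank A) + b *: S) *m row_ebase A.
  by rewrite mulmxDr mulmxDl -!scalemxAr -!scalemxAl mulmx_ebase.
rewrite mxrankMfree ?row_free_unit ?row_ebase_unit//.
rewrite (eqmxMfull _ _) ?row_full_unit ?col_ebase_unit//.
exact: shift_pencil_rank (leq_trans rA (rank_leq_row A)) rp rA ab.
Qed.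

End PencilExistence.

Section RankConditions.
Variables (F : numClosedFieldType) (N n : nat).

Definition rank_cond m (L : 'M[F]_(m, N)) r (M : 'M[F]_(N, n)) : Prop :=
  (r <= \rank (L *m M))%N.

(** Dividing by b reduces the points a x + b w of the pencil to x itself and the
    points z x + w. *)
Lemma rank_cond_rich m (L : 'M[F]_(m, N)) r :
  row_free L -> (r < m)%N || (r < n)%N -> pencil_rich (rank_cond L r).
Proof.
move=> /row_freeP[L' LL'] r_lt; split=> [x rx|x w d xw].
  have [C HC] := rank_pencil_exists rx r_lt.
  exists (L' *m C) => a b ab.
  by rewrite /rank_cond mulmxDr -!scalemxAr mulmxA LL' mul1mx; exact: HC.
have scaled_sum a b c : L *m (a *: x + b *: (w + c *: d)) =
    a *: (L *m x) + b *: (L *m w + c *: (L *m d)).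
  by rewrite mulmxDr -!scalemxAr mulmxDr -scalemxAr.
have rx : (r <= \rank (L *m x))%N.
  have := xw 1 0; rewrite oner_neq0 scale1r scale0r addr0; exact.
have rxw z : (r <= \rank (z *: (L *m x) + L *m w)%R)%N.
  have := xw z 1; rewrite oner_neq0 orbT scale1r /rank_cond mulmxDr -scalemxAr; exact.
apply: cofinitely_mono (rank_pencil_cofinite (L *m d) rx rxw) => c rc a b ab.
rewrite /rank_cond scaled_sum; have [b0|b0] := eqVneq b 0.
  rewrite b0 scale0r addr0 mxrank_scale_nz//.
  by move: ab; rewrite b0 eqxx orbF.
have -> : a *: (L *m x) + b *: (L *m w + c *: (L *m d)) =
    b *: ((a / b) *: (L *m x) + (L *m w + c *: (L *m d))).
  by rewrite [in RHS]scalerDr scalerA mulrCA mulfV// mulr1.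
by rewrite mxrank_scale_nz.
Qed.

Lemma rank_cond_line_cofinite m (L : 'M[F]_(m, N)) r : line_cofinite (rank_cond L r).
Proof.
move=> x d rx; have [P [Q PQ]] := rank_ge_mul1 rx.
pose p := \det (map_mx polyC (P *m (L *m x) *m Q) + 'X *: map_mx polyC (P *m (L *m d) *m Q)).
have pE c : p.[c] = \det (P *m (L *m (x + c *: d)) *m Q).
  rewrite -/(horner_eval c p) -det_map_mx map_mxD map_mxZ /= /horner_eval hornerX.
  congr (\det _); rewrite !(mulmxDr, mulmxDl) -!(scalemxAr, scalemxAl).
  by congr (_ + _ *: _); apply/matrixP => i j; rewrite !mxE hornerC.
have p0 : p != 0.
  apply/eqP => p0; have := pE 0; rewrite scale0r addr0 PQ det1 p0 horner0.
  by move/eqP; rewrite eq_sym oner_eq0.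
by apply: cofinitely_mono (cofinitely_poly p0) => c; rewrite pE; exact: det_rank_ge.
Qed.

End RankConditions.

(** * Paths and homotopies *)

Section PathTools.
Variables (R : realType).
Local Notation I := (unit_itv R).

(** A substitute for subdividing [0, 1] by a Lebesgue number: properties of
    subintervals that hold locally and pass to concatenations hold globally. *)
Lemma interval_induction (P : R -> R -> Prop) :
  (forall t, 0 <= t <= 1 -> exists2 e, 0 < e &
     forall a b, t - e < a -> a <= b -> b < t + e -> 0 <= a -> b <= 1 -> P a b) ->
  (forall a b c, P a b -> P b c -> P a c) -> P 0 1.
Proof.
move=> loc trans; pose A := [set x | 0 <= x <= 1 /\ P 0 x].
have A0 : A 0.
  split; first by rewrite lexx ler01.
  have [|e e0] := loc 0; first by rewrite lexx ler01.
  by apply; rewrite ?ler01 ?lexx//; lra.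
have supA : has_sup A by split; [exists 0 | exists 1 => x [/andP[]]].
have s0 : 0 <= sup A by apply: ub_le_sup => //; case: supA.
have s1 : sup A <= 1 by apply: ge_sup => [|x [/andP[]]//]; exists 0.
have [|e e0 Pe] := loc (sup A); first by rewrite s0.
have [a [/andP[a0 a1] P0a] sa] := sup_adherent e0 supA.
have as_ : a <= sup A by apply: ub_le_sup; [case: supA | split => //; rewrite a0].
pose b := Num.min 1 (sup A + e / 2).
have b1 : b <= 1 by rewrite ge_min lexx.
have ab : a <= b by rewrite le_min a1/=; lra.
have bs : b < sup A + e by rewrite gt_min; apply/orP; right; lra.
have P0b : P 0 b by apply: trans P0a _; exact: Pe.
have : b <= sup A.
  apply: ub_le_sup; first by case: supA.
  by split; rewrite // b1 (le_trans a0 ab).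
rewrite ge_min => /orP[s1'|]; last by lra.
by move: P0b; rewrite /b min_l//; lra.
Qed.

Section Loops.
Variable T : topologicalType.

Lemma path_homotopic_ends x y (f g : I -> T) : path_homotopic x y f g ->
  (f zero = x /\ f one = y) /\ (g zero = x /\ g one = y).
Proof. by case=> H [_ H0 H1 Hx Hy]; rewrite -!H0 -!H1 !Hx !Hy. Qed.

Definition affine_param (a b : R) (t : I) : I := clamp (a + (b - a) * val t).

Lemma affine_param_continuous a b : continuous (affine_param a b).
Proof.
apply: clamp_comp_continuous; apply: add_cts; first exact: cst_continuous.
by apply: mulc_cts; exact: val_continuous.
Qed.

Lemma affine_param0 a b : affine_param a b zero = clamp a.
Proof. by rewrite /affine_param zeroE val_clamp// mulr0 addr0. Qed.

Lemma affine_param1 a b : affine_param a b one = clamp b.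
Proof. by rewrite /affine_param oneE val_clamp// mulr1 addrC subrK. Qed.

Lemma sub_path_concat (f : I -> T) a b c : continuous f ->
  path_homotopic (f (clamp a)) (f (clamp c)) (f \o affine_param a c)
    (concat (f \o affine_param a b) (f \o affine_param b c)).
Proof.
move=> cf; have -> : concat (f \o affine_param a b) (f \o affine_param b c) =
    f \o concat (affine_param a b) (affine_param b c).
  by apply/funext => t; rewrite /concat /=; case: ifP.
apply: path_homotopic_reparam; rewrite ?concat0 ?concat1 ?affine_param0 ?affine_param1//.
  exact: affine_param_continuous.
by apply: concat_continuous; rewrite ?affine_param0 ?affine_param1//;
  exact: affine_param_continuous.
Qed.

(** A loop that contracts through loops contracts with fixed base point: push the
    edge {0} x I of the square across to the other three edges.  On these F runs
    along the path s |-> F (s, 0), stays at its end point, and runs back. *)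
Lemma free_null_homotopic (F : I * I -> T) : continuous F ->
  (forall t, F (one, t) = F (one, zero)) -> (forall s, F (s, one) = F (s, zero)) ->
  path_homotopic (F (zero, zero)) (F (zero, zero)) (fun t => F (zero, t))
    (cst (F (zero, zero))).
Proof.
move=> cF F1 Fper.
(* (u t, v t) runs along three edges of the square as t runs through three
   thirds of the interval. *)
pose u (t : I) : I := clamp (Num.min (3 * val t) (3 - 3 * val t)).
pose v (t : I) : I := clamp (3 * val t - 1).
have cu : continuous u.
  apply: clamp_comp_continuous; apply: min_cts.
    by apply: mulc_cts; exact: val_continuous.
  by apply: subc_cts; apply: mulc_cts; exact: val_continuous.
have cv : continuous v.
  by apply: clamp_comp_continuous; apply: addc_cts; apply: mulc_cts; exact: val_continuous.
have u0 : u zero = zero.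
  by rewrite /u zeroE val_clamp// mulr0 subr0 min_l//; lra.
have u1 : u one = zero.
  by rewrite /u oneE val_clamp// mulr1 subrr min_r//; lra.
have v0 : v zero = zero by rewrite /v zeroE val_clamp// clamp_le0//; lra.
have v1 : v one = one by rewrite /v oneE val_clamp// clamp_ge1//; lra.
have FuvE t : F (u t, v t) = F (u t, zero).
  have t0 := unit_itv_ge0 t; have t1 := unit_itv_le1 t.
  have [t3|t3] := leP (val t) 3^-1.
    by rewrite /v clamp_le0//; lra.
  have [t3'|t3'] := leP (val t) (2 / 3).
    have -> : u t = one; last exact: F1.
    by rewrite /u clamp_ge1// le_min; apply/andP; split; lra.
  by rewrite /v clamp_ge1 -?oneE ?Fper//; lra.
apply: (@path_homotopic_trans _ _ _ _ _ ((fun s => F (s, zero)) \o u)).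
  exists (fun st => F (clamp (val st.1 * val (u st.2)),
    clamp ((1 - val st.1) * val st.2 + val st.1 * val (v st.2)))).
  have cval2 (w : I -> I) : continuous w -> continuous (fun st : I * I => val (w st.2)).
    move=> cw; apply: (@comp_cts _ _ I (fun t => val (w t)) snd) => [|?]; last exact: cvg_snd.
    by apply: comp_cts => //; exact: val_continuous.
  split.
  - apply: comp_pair_continuous => //; apply: clamp_comp_continuous.
      by apply: mul_cts; [exact: val_fst_continuous | exact: cval2].
    apply: add_cts; apply: mul_cts; try exact: val_fst_continuous.
    + by apply: subc_cts; exact: val_fst_continuous.
    + exact: val_snd_continuous.
    + exact: cval2.
  - by move=> t; cbn [fst snd]; rewrite !zeroE val_clamp// !mul0r subr0 mul1r addr0 clampK.
  - move=> t; cbn [fst snd]; rewrite !oneE val_clamp// !mul1r subrr mul0r add0r !clampK.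
    exact: FuvE.
  - by move=> s; cbn [fst snd]; rewrite u0 v0 !zeroE val_clamp// !mulr0 addr0.
  - move=> s; cbn [fst snd]; rewrite u1 v1 !zeroE oneE !val_clamp// mulr0 !mulr1 subrK -oneE.
    exact: Fper.
have -> : cst (F (zero, zero)) = (fun s => F (s, zero)) \o (cst zero : I -> I) by [].
apply: path_homotopic_reparam; rewrite ?u0 ?u1//; last exact: cst_continuous.
apply: (comp_pair_continuous cF); first by move=> t; exact: cvg_id.
exact: cst_continuous.
Qed.

End Loops.
End PathTools.

(** * Continuity of matrix operations, and arcs in the complex plane *)

Section MatrixContinuity.
Variables (K : numFieldType) (T : topologicalType).

Lemma cts_mx_at m n (f : T -> 'M[K]_(m, n)) t :
  (forall i j, {for t, continuous (fun t => f t i j)}) -> {for t, continuous f}.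
Proof.
move=> cf A [P nP PA]; rewrite /nbhs /= in nP.
have : \forall s \near t, forall i j, P i j (f s i j).
  apply: filter_forall => i; apply: filter_forall => j.
  exact: cf (nP i j).
by apply: filterS => s Ps; apply: PA.
Qed.

Lemma cts_mx m n (f : T -> 'M[K]_(m, n)) :
  (forall i j, continuous (fun t => f t i j)) -> continuous f.
Proof. by move=> cf t; apply: cts_mx_at => i j; exact: cf. Qed.

Lemma cts_entry m n (f : T -> 'M[K]_(m, n)) i j :
  continuous f -> continuous (fun t => f t i j).
Proof.
move=> cf; apply: (@comp_cts _ _ _ (fun M : 'M[K]_(m, n) => M i j)) => //.
exact: coord_continuous.
Qed.

Lemma ctsD (f g : T -> K) : continuous f -> continuous g ->
  continuous (fun t => f t + g t).
Proof. by move=> cf cg t; apply: cvgD; [exact: cf | exact: cg]. Qed.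

Lemma ctsM (f g : T -> K) : continuous f -> continuous g ->
  continuous (fun t => f t * g t).
Proof. by move=> cf cg t; apply: cvgM; [exact: cf | exact: cg]. Qed.

Lemma cts_sum (J : Type) (r : seq J) (P : pred J) (f : J -> T -> K) :
  (forall j, continuous (f j)) -> continuous (fun t => \sum_(j <- r | P j) f j t).
Proof.
move=> cf; elim: r => [|j r IHr].
  by under eq_fun do rewrite big_nil; exact: cst_continuous.
under eq_fun do rewrite big_cons.
by case: (P j) => //; apply: ctsD.
Qed.

Lemma cts_prod (J : Type) (r : seq J) (P : pred J) (f : J -> T -> K) :
  (forall j, continuous (f j)) -> continuous (fun t => \prod_(j <- r | P j) f j t).
Proof.
move=> cf; elim: r => [|j r IHr].
  by under eq_fun do rewrite big_nil; exact: cst_continuous.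
under eq_fun do rewrite big_cons.
by case: (P j) => //; apply: ctsM.
Qed.

Lemma cts_mulmx m n p (f : T -> 'M[K]_(m, n)) (g : T -> 'M[K]_(n, p)) :
  continuous f -> continuous g -> continuous (fun t => f t *m g t).
Proof.
move=> cf cg; apply: cts_mx => i j; under eq_fun do rewrite mxE.
by apply: cts_sum => l; apply: ctsM; exact: cts_entry.
Qed.

Lemma cts_det n (f : T -> 'M[K]_n) : continuous f -> continuous (fun t => \det (f t)).
Proof.
move=> cf; apply: cts_sum => s; apply: ctsM; first exact: cst_continuous.
by apply: cts_prod => i; exact: cts_entry.
Qed.

Lemma cts_adj n (f : T -> 'M[K]_n) : continuous f -> continuous (fun t => \adj (f t)).
Proof.
move=> cf; apply: cts_mx => i j; under eq_fun do rewrite mxE.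
apply: ctsM; first exact: cst_continuous.
apply: cts_det; apply: cts_mx => k l; under eq_fun do rewrite !mxE.
exact: cts_entry.
Qed.

End MatrixContinuity.

(** The complex numbers with their bare structure of a field with norm, which is
    the one that determines the topology of Gr. *)
Definition complex_numfield (R : realType) : numFieldType := R[i].

Section ComplexArcs.
Variable R : realType.
Local Notation C := (complex_numfield R).

Lemma real_complex_continuous : continuous (fun x : R => x%:C%C : C).
Proof.
move=> x; apply/cvgrPdist_lt => e e0.
have eE : e = (complex.Re (e : R[i]))%:C%C by rewrite RRe_real// gtr0_real.
have e0' : 0 < complex.Re (e : R[i]) by move: e0; rewrite eE ltcR.
near=> y; rewrite eE -rmorphB normc_def /= expr0n/= addr0 sqrtr_sqr ltcR.
by near: y; apply: cvgr_dist_lt => //; exact: cvg_id.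
Unshelve. all: by end_near. Qed.

(** Arcs of parabolas from 0 to 1.  Different values of eta give arcs that are
    disjoint except at their ends, so that one of them avoids any given finite
    set. *)
Definition arc (eta t : R) : C := (t +i* (eta * t * (1 - t)))%C.

Lemma arc_continuous eta : continuous (arc eta).
Proof.
have -> : arc eta = fun t => t%:C%C + 'i%C * (eta * t * (1 - t))%:C%C.
  by apply/funext => t; rewrite /arc [LHS]complexE.
have cid : continuous (fun t : R => t) by move=> t; exact: cvg_id.
apply: ctsD; first exact: real_complex_continuous.
apply: ctsM; first exact: cst_continuous.
apply: (@comp_cts _ _ _ _ (fun t => eta * t * (1 - t))); first exact: real_complex_continuous.
by apply: ctsM; [exact: mulc_cts | exact: subc_cts].
Qed.

Lemma arc0 eta : arc eta 0 = 0. Proof. by rewrite /arc mulr0 mul0r. Qed.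
Lemma arc1 eta : arc eta 1 = 1. Proof. by rewrite /arc subrr mulr0. Qed.

Lemma norm_arc_le2 eta t : 0 <= eta <= 1 -> 0 <= t <= 1 -> `|arc eta t| <= 2.
Proof.
move=> /andP[eta0 eta1] /andP[t0 t1].
have normC (x : R) : 0 <= x -> `|x%:C%C : C| = x%:C%C by move=> ?; rewrite ger0_norm// ler0c.
rewrite /arc [X in `|X|]complexE (le_trans (ler_normD _ _))// normrM.
have -> : `|'i%C : C| = 1 by rewrite normc_def /= expr0n expr1n add0r sqrtr1.
rewrite mul1r !normC ?mulr_ge0 ?subr_ge0//= -rmorphD.
have -> : (2 : C) = 2%:C%C by rewrite rmorph_nat.
rewrite lecR; nra.
Qed.

Lemma arc_avoid (P : C -> Prop) : cofinitely P -> P 0 -> P 1 ->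
  exists2 eta : R, 0 <= eta <= 1 & forall t, 0 <= t <= 1 -> P (arc eta t).
Proof.
move=> [s sP] P0 P1.
have inj : injective (fun i => i.+1%:R^-1 : R).
  by move=> i j /invr_inj/eqP; rewrite eqr_nat eqSS => /eqP.
have [i is_] := fresh_value [seq complex.Im z / (complex.Re z * (1 - complex.Re z)) | z <- (s : seq R[i])] inj.
exists i.+1%:R^-1; first by rewrite invr_ge0 ler0n invf_le1 ?ler1n ?ltr0n.
move=> t /andP[t0 t1]; have [->|tn0] := eqVneq t 0; first by rewrite arc0.
have [->|tn1] := eqVneq t 1; first by rewrite arc1.
apply: sP; apply: contra is_ => ts; apply/mapP; exists (arc i.+1%:R^-1 t) => //.
by rewrite /arc /= -mulrA mulfK// mulf_neq0// subr_eq0 eq_sym.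
Qed.

End ComplexArcs.

(** * Paths in sets of complex matrices *)

Section Corestrict.
Variables (V : topologicalType) (S : set V).

Definition corestrict (A : Type) (f : A -> V) (fS : forall a, S (f a)) : A -> set_type S :=
  fun a => exist (fun x => x \in S) (f a) (mem_set (fS a)).

Lemma corestrict_continuous (A : topologicalType) (f : A -> V) (fS : forall a, S (f a)) :
  continuous f -> continuous (corestrict fS).
Proof. by move=> cf; apply: continuous_comp_initial. Qed.

Lemma set_type_in (x : set_type S) : S (val x).
Proof. exact: set_valP. Qed.

Lemma set_val_continuous : continuous (val : set_type S -> V).
Proof. exact: initial_continuous. Qed.

End Corestrict.

Section MatrixPaths.
Variables (R : realType) (m n : nat).
Local Notation I := (unit_itv R).
Local Notation C := (complex_numfield R).
Local Notation V := 'M[C]_(m, n).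
Local Notation "r %:K" := (r%:C%C : C) (at level 2, format "r %:K").
Variable S : set V.
Local Notation X := (set_type S).

Definition segment (x y : V) (s : R) : V := (1 - s)%:K *: x + s%:K *: y.

Lemma segment0 x y : segment x y 0 = x.
Proof. by rewrite /segment subr0 rmorph1 rmorph0 scale1r scale0r addr0. Qed.

Lemma segment1 x y : segment x y 1 = y.
Proof. by rewrite /segment subrr rmorph1 rmorph0 scale1r scale0r add0r. Qed.

Lemma segmentxx x s : segment x x s = x.
Proof. by rewrite /segment -scalerDl -rmorphD subrK rmorph1 scale1r. Qed.

Lemma segment_continuous (T : topologicalType) (f g : T -> V) (u : T -> R) :
  continuous f -> continuous g -> continuous u ->
  continuous (fun t => segment (f t) (g t) (u t)).
Proof.
move=> cf cg cu; apply: cts_mx => i j; rewrite /segment.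
under eq_fun do rewrite !mxE.
have cK (w : T -> R) : continuous w -> continuous (fun t => (w t)%:K).
  by move=> cw; apply: comp_cts cw; exact: real_complex_continuous.
apply: ctsD; apply: ctsM.
- by apply: (cK (fun t => 1 - u t)); exact: subc_cts.
- exact: cts_entry.
- exact: cK.
- exact: cts_entry.
Qed.

Lemma segment_homotopic x y (f g : I -> X) : continuous f -> continuous g ->
  f zero = x -> f one = y -> g zero = x -> g one = y ->
  (forall t s, 0 <= s <= 1 -> S (segment (val (f t)) (val (g t)) s)) ->
  path_homotopic x y f g.
Proof.
move=> cf cg f0 f1 g0 g1 fgS.
pose h (st : I * I) := segment (val (f st.2)) (val (g st.2)) (val st.1).
have hS st : S (h st) by apply: fgS; rewrite unit_itv_ge0 unit_itv_le1.
have cval (u : I -> X) : continuous u -> continuous (fun st : I * I => val (u st.2)).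
  move=> cu; apply: (@comp_cts _ _ I (fun t => val (u t)) snd) => [|?]; last exact: cvg_snd.
  by apply: comp_cts => //; exact: set_val_continuous.
exists (corestrict hS); split.
- apply: corestrict_continuous; apply: segment_continuous; try exact: cval.
  exact: val_fst_continuous.
- by move=> t; apply: val_inj; rewrite /= /h zeroE val_clamp// segment0.
- by move=> t; apply: val_inj; rewrite /= /h oneE val_clamp// segment1.
- by move=> s; apply: val_inj; rewrite /= /h f0 g0 segmentxx.
- by move=> s; apply: val_inj; rewrite /= /h f1 g1 segmentxx.
Qed.

Definition line (x y : V) (c : C) : V := x + c *: (y - x).

Lemma line0 x y : line x y 0 = x. Proof. by rewrite /line scale0r addr0. Qed.
Lemma line1 x y : line x y 1 = y. Proof. by rewrite /line scale1r addrC subrK. Qed.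

Lemma line_continuous x y : continuous (line x y : C -> V).
Proof.
apply: cts_mx => i j; rewrite /line; under eq_fun do rewrite !mxE.
apply: ctsD; first exact: cst_continuous.
by apply: ctsM; [move=> c; exact: cvg_id | exact: cst_continuous].
Qed.

Lemma arc_path (P : V -> Prop) x y : P x -> P y ->
  cofinitely (fun c => P (line x y c)) ->
  exists2 eta : R, 0 <= eta <= 1 & forall t : I, P (line x y (arc eta (val t))).
Proof.
move=> Px Py cofP; have [||eta eta01 Peta] := arc_avoid cofP.
- by rewrite line0.
- by rewrite line1.
by exists eta => // t; apply: Peta; rewrite unit_itv_ge0 unit_itv_le1.
Qed.

Lemma arc_path_continuous x y eta :
  continuous (fun t : I => line x y (arc eta (val t))).
Proof.
apply: (@comp_cts _ _ _ (line x y) (fun t : I => arc eta (val t))).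
  exact: line_continuous.
by apply: comp_cts; [exact: arc_continuous | exact: val_continuous].
Qed.

(** B is a convex polydisc in S and U the concentric one of a fifth of its size.
    The complex line through two points of U stays in B as long as its parameter
    has modulus at most 2, which covers the arcs above. *)
Lemma open_box x : open S -> S x -> exists (U B : set V),
  [/\ nbhs x U, U `<=` B, B `<=` S,
    forall a b s, B a -> B b -> 0 <= s <= 1 -> B (segment a b s) &
    forall a b c, U a -> U b -> `|c| <= 2 -> B (line a b c)].
Proof.
move=> oS Sx; have [P nP PS] : nbhs x S by exact: open_nbhs_nbhs.
have dP i j : exists d : C, 0 < d /\ ball (x i j) (d * 5) `<=` P i j.
  have /nbhs_ballP[e e0 eP] := nP i j.
  by exists (e / 5); rewrite divr_gt0// divfK// pnatr_eq0.
have [d dE] := choice (fun ij : 'I_m * 'I_n => dP ij.1 ij.2).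
pose box k : set V := [set y | forall i j, `|x i j - y i j| < d (i, j) * k].
(* With |x - a|, |x - b| < d and |c| <= 2 the point a + c (b - a) is at distance
   less than d + 2 (d + d) = 5 d from x. *)
exists (box 1), (box 5); split.
- exists (fun i j => ball (x i j) (d (i, j))) => [i j|y yb i j].
    by apply: nbhsx_ballx; have [] := dE (i, j).
  by have := yb i j; rewrite mulr1.
- move=> y yb i j; apply: (lt_le_trans (yb i j)).
  by rewrite ler_pM2l ?ler1n//; have [] := dE (i, j).
- by move=> y yb; apply: PS => i j; have [_] := dE (i, j); apply; exact: yb.
- move=> a b s Ba Bb /andP[s0 s1] i j; rewrite !mxE.
  have -> : x i j - ((1 - s)%:K * a i j + s%:K * b i j) =
      (1 - s)%:K * (x i j - a i j) + s%:K * (x i j - b i j).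
    by rewrite rmorphB rmorph1; ring.
  have s0' : 0 <= s%:K by rewrite ler0c.
  have s1' : 0 <= (1 - s)%:K by rewrite ler0c subr_ge0.
  apply: (le_lt_trans (ler_normD _ _)); rewrite !normrM (ger0_norm s0') (ger0_norm s1').
  have -> : d (i, j) * 5 = (1 - s)%:K * (d (i, j) * 5) + s%:K * (d (i, j) * 5).
    by rewrite rmorphB rmorph1; ring.
  have [->|sn0] := eqVneq s 0.
    by rewrite rmorph0 !mul0r !addr0 subr0 rmorph1 !mul1r; exact: Ba.
  apply: ler_ltD; first by rewrite ler_wpM2l// ltW//; exact: Ba.
  by rewrite ltr_pM2l; [exact: Bb | rewrite ltcR lt_neqAle eq_sym sn0].
- move=> a b c Ua Ub c2 i j; rewrite !mxE.
  have -> : x i j - (a i j + c * (b i j - a i j)) =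
      (x i j - a i j) + c * ((x i j - b i j) - (x i j - a i j)) by ring.
  have -> : d (i, j) * 5 = d (i, j) * 1 + 2 * (d (i, j) * 1 + d (i, j) * 1) by ring.
  apply: (le_lt_trans (ler_normD _ _)); apply: ltr_leD; first exact: Ua.
  rewrite normrM; apply: ler_pM => //; apply: (le_trans (ler_normB _ _)).
  by apply: lerD; apply: ltW; [exact: Ub | exact: Ua].
Qed.

End MatrixPaths.

(** * Open pencil-rich sets are simply connected *)

Section RichSimplyConnected.
Variables (R : realType) (m n : nat).
Local Notation I := (unit_itv R).
Local Notation C := (complex_numfield R).
Local Notation V := 'M[C]_(m, n).
Variable S : set V.
Hypotheses (oS : open S) (richS : pencil_rich S).
Local Notation X := (set_type S).

Lemma pencil_in_l x w : pencil_in S x w -> S x.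
Proof. by move=> /(_ 1 0); rewrite oner_neq0 scale1r scale0r addr0; exact. Qed.

Lemma pencil_in_segment x w s : pencil_in S x w -> S (segment x w s).
Proof.
apply; have [->|s0] := eqVneq s 0; first by rewrite subr0 rmorph1 oner_neq0.
by apply/orP; right; apply: contra s0 => /eqP[->].
Qed.

(** The finitely many points in s are the division points of f.  Stating the
    conclusion for all w that suit them makes the property compatible with
    concatenation, before w is chosen. *)
Lemma push_into_pencils (f : I -> X) : continuous f ->
  exists2 s : seq V, (forall v, v \in s -> S v) &
    forall w, (forall v, v \in s -> pencil_in S v w) ->
    exists g : I -> X, [/\ continuous g, forall t, pencil_in S (val (g t)) w &
      path_homotopic (f zero) (f one) f g].
Proof.
move=> cf.
pose P (a b : R) := exists2 s : seq V, (forall v, v \in s -> S v) &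
  forall w, (forall v, v \in s -> pencil_in S v w) ->
  exists g : I -> X, [/\ continuous g, forall t, pencil_in S (val (g t)) w &
    path_homotopic (f (clamp a)) (f (clamp b)) (f \o affine_param a b) g].
have fE : f = f \o affine_param 0 1.
  by apply/funext => t; rewrite /= /affine_param subr0 mul1r add0r clampK.
rewrite [X in path_homotopic _ _ X]fE zeroE oneE; apply: (@interval_induction R P); last first.
  move=> a b c [s1 s1S Hs1] [s2 s2S Hs2]; exists (s1 ++ s2).
    by move=> v; rewrite mem_cat => /orP[/s1S|/s2S].
  move=> w sw.
  have [|g1 [cg1 g1w h1]] := Hs1 w; first by move=> v vs; apply: sw; rewrite mem_cat vs.
  have [|g2 [cg2 g2w h2]] := Hs2 w; first by move=> v vs; apply: sw; rewrite mem_cat vs orbT.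
  have [_ [_ g1b]] := path_homotopic_ends h1.
  have [_ [g2b _]] := path_homotopic_ends h2.
  exists (concat g1 g2); split.
  - by apply: concat_continuous; rewrite ?g1b.
  - by move=> t; rewrite /concat; case: ifP.
  - apply: path_homotopic_trans (sub_path_concat a b c cf) _.
    exact: path_homotopic_concat h1 h2.
move=> t t01.
have [U [B [nU UB BS Bconv Uline]]] := open_box oS (set_type_in (f (clamp t))).
pose h r := val (f (clamp r)).
have ch : continuous h.
  apply: (@comp_cts _ _ _ (val : X -> V)); first exact: set_val_continuous.
  by apply: comp_cts => //; exact: clamp_continuous.
have /nbhs_ballP[e e0 eU] : nbhs t (h @^-1` U) by exact: ch.
exists e => // a b ta ab bt a0 b1.
have hU r : a <= r <= b -> U (h r).
  by move=> /andP[ar rb]; apply: eU; rewrite /ball /= ltr_norml; apply/andP; split; lra.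
have Ua : U (h a) by apply: hU; rewrite lexx.
have Ub : U (h b) by apply: hU; rewrite lexx ab.
exists [:: h a; h b].
  by move=> v; rewrite !inE => /orP[/eqP->|/eqP->]; exact: set_type_in.
move=> w hw.
have aw : pencil_in S (h a) w by apply: hw; rewrite mem_head.
have bw : pencil_in S (h b) w by apply: hw; rewrite !inE eqxx orbT.
have [|eta eta01 etaw] := @arc_path R m n (fun v => pencil_in S v w) _ _ aw bw.
  apply: cofinitely_mono (richS.2 w (h a) (h b - h a) (pencil_in_sym aw)) => c.
  exact: pencil_in_sym.
have gS (u : I) : S (line (h a) (h b) (arc eta (val u))) by exact: pencil_in_l (etaw u).
have cg : continuous (corestrict gS).
  by apply: corestrict_continuous; exact: arc_path_continuous.
exists (corestrict gS); split => //.
apply: segment_homotopic => //.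
- by apply: comp_cts => //; exact: affine_param_continuous.
- by rewrite /= affine_param0.
- by rewrite /= affine_param1.
- apply: val_inj; rewrite -[LHS]/(line (h a) (h b) (arc eta (val (zero : I)))).
  by rewrite zeroE val_clamp// arc0 line0.
- apply: val_inj; rewrite -[LHS]/(line (h a) (h b) (arc eta (val (one : I)))).
  by rewrite oneE val_clamp// arc1 line1.
move=> u s s01; apply: BS; apply: Bconv => //.
  apply: UB; apply: hU; have u0 := unit_itv_ge0 u; have u1 := unit_itv_le1 u.
  have ab0 : 0 <= b - a by rewrite subr_ge0.
  by apply/andP; split; nra.
apply: Uline => //; apply: norm_arc_le2 => //.
by rewrite unit_itv_ge0 unit_itv_le1.
Qed.

(** The segment from a point of g to w lies in the pencil that they span. *)
Lemma cone_null_homotopic x w (g : I -> X) : continuous g ->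
  g zero = x -> g one = x -> (forall t, pencil_in S (val (g t)) w) ->
  path_homotopic x x g (cst x).
Proof.
move=> cg g0 g1 gw.
pose h (st : I * I) := segment (val (g st.2)) w (val st.1).
have hS st : S (h st) by exact: pencil_in_segment.
have ch : continuous (corestrict hS).
  apply: corestrict_continuous; apply: segment_continuous.
  - apply: (@comp_cts _ _ I (fun t => val (g t)) snd) => [|?]; last exact: cvg_snd.
    by apply: comp_cts => //; exact: set_val_continuous.
  - exact: cst_continuous.
  - exact: val_fst_continuous.
have h0 t : corestrict hS (zero, t) = g t.
  by apply: val_inj; rewrite /= /h zeroE val_clamp// segment0.
have -> : g = fun t => corestrict hS (zero, t) by apply/funext => t; rewrite h0.
have := free_null_homotopic ch; rewrite h0 g0; apply.
  by move=> t; apply: val_inj; rewrite /= /h oneE val_clamp// !segment1.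
by move=> s; apply: val_inj; rewrite /= /h g0 g1.
Qed.

Theorem rich_null_homotopic x (f : I -> X) : continuous f ->
  f zero = x -> f one = x -> path_homotopic x x f (cst x).
Proof.
move=> cf f0 f1; have [s sS Hs] := push_into_pencils cf.
have [||w sw] := @line_cofinite_common C V V s (pencil_in S).
- by move=> v vs; apply: richS.1; exact: sS.
- by move=> v _; exact: richS.2.
have [g [cg gw fg]] := Hs w sw; rewrite f0 f1 in fg.
have [_ [g0 g1]] := path_homotopic_ends fg.
by apply: path_homotopic_trans fg _; exact: cone_null_homotopic gw.
Qed.

End RichSimplyConnected.

(** * Local sections and path lifting for Grassmannians *)

Section RowSpans.
Variables (K : numFieldType) (n : nat).

Lemma mem_row_span k (M : 'M[K]_(k, n)) v :
  (v \in <<frame_rows M>>%VS) = (v <= M)%MS.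
Proof.
apply/idP/idP => [|/submxP[D ->]]; last first.
  rewrite mulmx_sum_row rpred_sum// => i _; rewrite rpredZ// memv_span//.
  by apply/mapP; exists i; rewrite ?mem_enum.
pose f := linfun (mulmxr M : 'rV[K]_k -> 'rV[K]_n).
suff /subvP sub : (<<frame_rows M>> <= limg f)%VS.
  by move=> /sub/memv_imgP[u _ ->]; rewrite lfunE /= submxMl.
apply/span_subvP => _ /mapP[i _ ->].
by apply/memv_imgP; exists (delta_mx 0 i); rewrite ?memvf// lfunE /= -rowE.
Qed.

Lemma row_span_sub k l (M : 'M[K]_(k, n)) (N : 'M[K]_(l, n)) :
  (<<frame_rows M>> <= <<frame_rows N>>)%VS = (M <= N)%MS.
Proof.
apply/subvP/idP => [MN|MN v]; last first.
  by rewrite !mem_row_span => /submx_trans; exact.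
by apply/row_subP => i; rewrite -mem_row_span MN// mem_row_span row_sub.
Qed.

Lemma row_span_eq k l (M : 'M[K]_(k, n)) (N : 'M[K]_(l, n)) :
  (<<frame_rows M>>%VS == <<frame_rows N>>%VS) = (M == N)%MS.
Proof. by rewrite eqEsubv !row_span_sub. Qed.

Lemma row_free_free k (M : 'M[K]_(k, n)) : row_free M -> free (frame_rows M).
Proof.
move=> freeM; have -> : frame_rows M = [tuple row i M | i < k] by [].
apply/freeP => c; under eq_bigr do rewrite -tnth_nth tnth_mktuple.
move=> c0 i; have : (\row_j c j) *m M = 0.
  by rewrite mulmx_sum_row -[RHS]c0; apply: eq_bigr => j _; rewrite mxE.
by move/eqP; rewrite mulmx_free_eq0// => /eqP/rowP/(_ i); rewrite !mxE.
Qed.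

Lemma dim_row_span k (M : 'M[K]_(k, n)) : \dim <<frame_rows M>>%VS = \rank M.
Proof.
have -> : <<frame_rows M>>%VS = <<frame_rows (row_base M)>>%VS.
  by apply/eqP; rewrite row_span_eq !eq_row_base submx_refl.
rewrite (eqP (row_free_free (row_base_free M))).
by rewrite size_map size_enum_ord.
Qed.

End RowSpans.

Section GrassmannLifting.
Variables (K : numFieldType) (k n : nat).
Local Notation Gr := (Gr K k n).

Definition spans (M : 'M[K]_(k, n)) (V : Gr) : Prop := <<frame_rows M>>%VS = val V.

Lemma spans_row_free M V : spans M V -> row_free M.
Proof. by move=> MV; rewrite /row_free -dim_row_span MV (valP V). Qed.

Lemma spans_frame_span (F : frame K k n) : spans (val F) (frame_span F).
Proof. by []. Qed.

Lemma spans_Gr_frame V : spans (val (Gr_frame V)) V.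
Proof. by rewrite /spans -[in RHS](Gr_frameK V). Qed.

Lemma spans_mull M V (g : 'M[K]_k) : g \in unitmx -> spans M V -> spans (g *m M) V.
Proof.
rewrite /spans => ug <-; apply/eqP; rewrite row_span_eq.
by apply/eqmxP; apply: eqmxMfull; rewrite row_full_unit.
Qed.

Lemma spans_unique M V V' : spans M V -> spans M V' -> V = V'.
Proof. by move=> MV MV'; apply: val_inj; rewrite -MV -MV'. Qed.

Lemma spans_change M M' V : spans M V -> spans M' V ->
  exists2 g : 'M[K]_k, g \in unitmx & M' = g *m M.
Proof.
move=> MV M'V; have /submxP[g M'E] : (M' <= M)%MS.
  by rewrite -row_span_sub MV M'V.
exists g => //; rewrite -row_full_unit /row_full eqn_leq rank_leq_row/=.
by rewrite -{1}(eqP (spans_row_free M'V)) M'E mxrankM_maxl.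
Qed.

Definition chart_dom (Q : 'M[K]_(n, k)) : set Gr :=
  [set V | val (Gr_frame V) *m Q \in unitmx].

(** The frame of V that Q maps to the identity matrix; it does not depend on the
    frame of V used to compute it. *)
Definition chart_section (Q : 'M[K]_(n, k)) (V : Gr) : 'M[K]_(k, n) :=
  invmx (val (Gr_frame V) *m Q) *m val (Gr_frame V).

Lemma chart_domE Q M V : spans M V -> chart_dom Q V <-> M *m Q \in unitmx.
Proof.
move=> MV; have [g ug ->] := spans_change (spans_Gr_frame V) MV.
by rewrite -mulmxA unitmx_mul ug.
Qed.

Lemma chart_sectionE Q M V : spans M V -> chart_dom Q V ->
  chart_section Q V = invmx (M *m Q) *m M.
Proof.
move=> MV QV; have [g ug ->] := spans_change (spans_Gr_frame V) MV.
rewrite /chart_section; set N := val (Gr_frame V); have uN : N *m Q \in unitmx by [].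
apply/esym/(canLR (mulKmx _)); first by rewrite -mulmxA unitmx_mul ug.
by rewrite -[g *m N *m Q]mulmxA -mulmxA mulKVmx.
Qed.

Lemma frame_span_continuous : continuous (@frame_span K k n).
Proof. by apply/continuousP => U; rewrite Gr_openE. Qed.

Lemma chart_section_spans Q V : chart_dom Q V -> spans (chart_section Q V) V.
Proof. by move=> QV; apply: spans_mull (spans_Gr_frame V); rewrite unitmx_inv. Qed.

(** Cramer's rule expresses the inverse by determinants, which are continuous. *)
Lemma normalize_continuous (Q : 'M[K]_(n, k)) (M : 'M[K]_(k, n)) (U : set 'M[K]_(k, n)) :
  M *m Q \in unitmx -> nbhs (invmx (M *m Q) *m M) U ->
  \forall N \near M, N *m Q \in unitmx /\ U (invmx (N *m Q) *m N).
Proof.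
move=> uMQ nU.
have cmul : continuous (fun N : 'M[K]_(k, n) => N *m Q).
  by apply: cts_mulmx; [move=> N; exact: cvg_id | exact: cst_continuous].
have cdet : continuous (fun N : 'M[K]_(k, n) => \det (N *m Q)) by exact: cts_det.
have unitE (N : 'M[K]_(k, n)) : (N *m Q \in unitmx) = (\det (N *m Q) != 0).
  by rewrite unitmxE unitfE.
pose psi (N : 'M[K]_(k, n)) := (\det (N *m Q))^-1 *: \adj (N *m Q) *m N.
have psiE N : N *m Q \in unitmx -> psi N = invmx (N *m Q) *m N.
  by move=> uN; rewrite /invmx uN.
have near_unit : \forall N \near M, N *m Q \in unitmx.
  have : \forall N \near M, \det (N *m Q) != 0.
    apply: (@cvgr_neq0 K K _ (nbhs M) _ (fun N => \det (N *m Q)) _ (cdet M)).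
    by rewrite -unitE.
  by apply: filterS => N; rewrite unitE.
have cpsi : {for M, continuous psi}.
  apply: cts_mx_at => i j.
  have psi_ij : (fun N => psi N i j) =
      fun N => (\det (N *m Q))^-1 * (\adj (N *m Q) *m N) i j.
    by apply/funext => N; rewrite /psi -scalemxAl mxE.
  change (continuous_at M (fun N => psi N i j)); rewrite psi_ij.
  apply: cvgM; first exact: nbhs_filter.
    by apply: cvgV (cdet M); rewrite -unitE.
  have cnum : continuous (fun N : 'M[K]_(k, n) => (\adj (N *m Q) *m N) i j).
    apply: cts_entry; apply: cts_mulmx; last by move=> N; exact: cvg_id.
    exact: cts_adj.
  exact: cnum.
have : \forall N \near M, U (psi N) by apply: cpsi; rewrite psiE.
by apply: filterS2 near_unit => N uN; rewrite psiE.
Qed.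

Lemma chart_section_continuous Q V : chart_dom Q V ->
  {for V, continuous (chart_section Q)} /\ nbhs V (chart_dom Q).
Proof.
move=> QV.
have key (O : set 'M[K]_(k, n)) : open O -> O (chart_section Q V) ->
    nbhs V [set W | chart_dom Q W /\ O (chart_section Q W)].
  move=> oO OV; apply: open_nbhs_nbhs; split => //.
  rewrite Gr_openE openE => F /= [QF OF].
  have uF : val F *m Q \in unitmx by move/(chart_domE Q (spans_frame_span F)) : QF.
  move: OF; rewrite (chart_sectionE (spans_frame_span F) QF) => OF.
  have nO : nbhs (invmx (val F *m Q) *m val F) O by exact: open_nbhs_nbhs.
  have nF : nbhs (F : frame K k n) [set F' : frame K k n |
      val F' *m Q \in unitmx /\ O (invmx (val F' *m Q) *m val F')].
    exact: (@initial_continuous _ _ (val : frame K k n -> 'M[K]_(k, n)) F _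
      (normalize_continuous uF nO)).
  suff sub : [set F' : frame K k n |
      val F' *m Q \in unitmx /\ O (invmx (val F' *m Q) *m val F')] `<=`
      [set F' | chart_dom Q (frame_span F') /\ O (chart_section Q (frame_span F'))].
    exact: filterS sub nF.
  move=> F' /= [uF' OF'].
  have QF' : chart_dom Q (frame_span F') by apply/(chart_domE Q (spans_frame_span F')).
  by split; rewrite // (chart_sectionE (spans_frame_span F') QF').
split; last by apply: filterS (key setT openT Logic.I) => W [].
move=> A; rewrite nbhsE => -[O [oO OV] OA].
by apply: filterS (key O oO OV) => W [_ /OA].
Qed.

End GrassmannLifting.

Section PathLifting.
Variables (R : realType) (K : numFieldType) (k n : nat).
Local Notation I := (unit_itv R).
Local Notation Gr := (Gr K k n).

(** Inside the domain of a chart the lift that starts at a given frame M is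
    (M Q) times the section of the chart.  Carrying the starting frame along
    makes the local lifts fit together. *)
Lemma Gr_path_lift (g : I -> Gr) (N : 'M[K]_(k, n)) : continuous g ->
  spans N (g zero) -> exists f : I -> 'M[K]_(k, n),
    [/\ continuous f, f zero = N & forall t, spans (f t) (g t)].
Proof.
move=> cg gN; pose gR r := g (clamp r).
have cgR : continuous gR by apply: comp_cts => //; exact: clamp_continuous.
pose P (a b : R) := a <= b /\ forall M, spans M (gR a) -> exists f : R -> 'M[K]_(k, n),
  [/\ continuous f, f a = M & forall r, a <= r <= b -> spans (f r) (gR r)].
suff [_ /(_ N)[]] : P 0 1.
- by rewrite /gR -zeroE.
- move=> f [cf f0 fs]; exists (fun t => f (val t)); split.
  + by apply: comp_cts => //; exact: val_continuous.
  + by rewrite zeroE val_clamp.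
  + move=> t; have := fs (val t); rewrite /gR clampK; apply.
    by rewrite unit_itv_ge0 unit_itv_le1.
apply: interval_induction; last first.
  move=> a b c [ab Pab] [bc Pbc]; split=> [|M Ma]; first exact: le_trans ab bc.
  have [f [cf fa fs]] := Pab M Ma.
  have [|f' [cf' f'b f's]] := Pbc (f b); first by apply: fs; rewrite ab lexx.
  exists (fun r => if r <= b then f r else f' r); split.
  - apply: (@continuous_if_le R _ _ (fun r => r)) => //; first by move=> r; exact: cvg_id.
    by move=> r ->.
  - by rewrite ab.
  - move=> r /andP[ar rc]; case: leP => rb; first by apply: fs; rewrite ar.
    by apply: f's; rewrite ltW.
move=> t _; have /row_freeP[Q NQ] := spans_row_free (spans_Gr_frame (gR t)).
have Qt : chart_dom Q (gR t) by rewrite /chart_dom /= NQ unitmx1.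
have [_ nQ] := chart_section_continuous Qt.
have /nbhs_ballP[e e0 eQ] : nbhs t (gR @^-1` chart_dom Q) by exact: cgR.
exists e => // a b ta ab bt a0 b1; split=> // M Ma.
(* The parameter is truncated to [a, b] in order to get a function that is
   continuous on all of R. *)
pose trunc r := Num.max a (Num.min b r).
have ctrunc : continuous trunc.
  move=> r; apply: continuous_max; first exact: cvg_cst.
  by apply: continuous_min; [exact: cvg_cst | exact: cvg_id].
have Qtrunc r : chart_dom Q (gR (trunc r)).
  apply: eQ; rewrite /ball /= ltr_norml.
  have ar : a <= trunc r by rewrite le_max lexx.
  have rb : trunc r <= b by rewrite ge_max ab ge_min lexx.
  by apply/andP; split; lra.
have truncE r : a <= r <= b -> trunc r = r.
  by move=> /andP[ar rb]; rewrite /trunc min_r// max_r.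
exists (fun r => (M *m Q) *m chart_section Q (gR (trunc r))); split.
- apply: cts_mulmx; first exact: cst_continuous.
  move=> r; apply: (@continuous_comp _ _ _ (fun r => gR (trunc r)) (chart_section Q)).
    by apply: (@comp_cts _ _ _ gR trunc).
  by have [+ _] := chart_section_continuous (Qtrunc r); exact.
- have Qa := Qtrunc a; rewrite truncE ?lexx// in Qa *.
  rewrite (chart_sectionE Ma Qa) mulKVmx//.
  by apply/(chart_domE Q Ma).
- move=> r rab; have Qr := Qtrunc r; rewrite truncE// in Qr *.
  apply: spans_mull; last exact: chart_section_spans.
  have Qa := Qtrunc a; rewrite truncE ?lexx// in Qa.
  by apply/(chart_domE Q Ma).
Qed.

End PathLifting.

(** * Tuples of frames over the configuration space *)

Section Blocks.
Variables (K : numFieldType) (h k n : nat).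

Definition block (a : 'I_h) (M : 'M[K]_(h * k, n)) : 'M[K]_(k, n) :=
  rowsub (mxvec_index a) M.

Definition pair_index (a b : 'I_h) (i : 'I_(k + k)) : 'I_(h * k) :=
  match fintype.split i with inl j => mxvec_index a j | inr j => mxvec_index b j end.

Lemma mxvec_index_inj (a b : 'I_h) (i j : 'I_k) :
  mxvec_index a i = mxvec_index b j -> a = b /\ i = j.
Proof.
by move=> /cast_ord_inj/enum_rank_inj[].
Qed.

Lemma pair_index_inj a b : a != b -> injective (pair_index a b).
Proof.
move=> ab i j; rewrite /pair_index => ij; apply: (can_inj splitK); move: ij.
case: (fintype.split i) (fintype.split j) => [i'|i'] [j'|j'] /mxvec_index_inj[e1 e2].
- by rewrite e2.
- by rewrite e1 eqxx in ab.
- by rewrite e1 eqxx in ab.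
- by rewrite e2.
Qed.

Lemma pair_rowsub a b (M : 'M[K]_(h * k, n)) :
  rowsub (pair_index a b) M = col_mx (block a M) (block b M).
Proof.
apply/matrixP => i j; rewrite /pair_index !mxE.
by case: (fintype.split i) => i'; rewrite !mxE.
Qed.

Lemma rowsub_id m p (M : 'M[K]_(m, p)) : rowsub id M = M.
Proof. by apply/matrixP => i j; rewrite mxE. Qed.

Lemma row_free_rowsub1 m N (f : 'I_m -> 'I_N) :
  injective f -> row_free (rowsub f 1%:M : 'M[K]_(m, N)).
Proof.
move=> f_inj; apply/row_freeP; exists (colsub f 1%:M).
rewrite mul_rowsub_mx mul1mx; apply/matrixP => i j.
by rewrite !mxE (inj_eq f_inj).
Qed.

Definition assemble (g : 'I_h -> 'M[K]_(k, n)) : 'M[K]_(h * k, n) :=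
  \matrix_(r, l) mxvec (\matrix_(a < h, j < k) g a j l) 0 r.

Lemma block_assemble g a : block a (assemble g) = g a.
Proof. by apply/matrixP => j l; rewrite !mxE mxvecE mxE. Qed.

Lemma assembleE g a j l : assemble g (mxvec_index a j) l = g a j l.
Proof. by rewrite !mxE mxvecE mxE. Qed.

Lemma cts_assemble (T : topologicalType) (g : T -> 'I_h -> 'M[K]_(k, n)) :
  (forall a, continuous (g^~ a)) -> continuous (fun t => assemble (g t)).
Proof.
move=> cg; apply: cts_mx => r l; case/mxvec_indexP: r => a j.
under eq_fun do rewrite assembleE.
by apply: cts_entry; exact: cg.
Qed.

Lemma cts_block a : continuous (block a).
Proof.
by apply: cts_mx => i j; under eq_fun do rewrite mxE; apply: coord_continuous.
Qed.

Lemma block_sum_span (M : 'M[K]_(h * k, n)) :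
  (\sum_(a < h) <<frame_rows (block a M)>>)%VS = <<frame_rows M>>%VS.
Proof.
apply/eqP; rewrite eqEsubv; apply/andP; split.
  apply/subv_sumP => a _; rewrite row_span_sub.
  by apply/row_subP => j; rewrite row_rowsub row_sub.
apply/span_subvP => _ /mapP[r _ ->]; case/mxvec_indexP: r => a j.
have : (<<frame_rows (block a M)>> <= \sum_(a < h) <<frame_rows (block a M)>>)%VS.
  exact: (sumv_sup a).
move/subvP; apply; rewrite mem_row_span.
by have := row_sub j (block a M); rewrite row_rowsub.
Qed.

(** For blocks of rank k, to have different row spans is a lower bound on a joint
    rank as well; so one argument covers all three conditions. *)
Definition conf_frames : set 'M[K]_(h * k, n) := [set M |
  [/\ (minn n (h * k) <= \rank M)%N, forall a, (k <= \rank (block a M))%N &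
    forall a b, a != b -> (k < \rank (col_mx (block a M) (block b M)))%N]].

(** The dimension of the sum is the rank of M, and two blocks of rank k with a
    joint rank of at most k have the same row span. *)
Lemma conf_framesP (M : 'M[K]_(h * k, n)) (H : 'I_h -> Gr K k n) :
  (forall a, spans (block a M) (H a)) ->
  conf_frames M <-> injective H /\ \dim (\sum_(a < h) val (H a))%VS = minn n (h * k).
Proof.
move=> MH; have dimE : \dim (\sum_(a < h) val (H a))%VS = \rank M.
  by rewrite -dim_row_span -block_sum_span; congr (\dim _); apply: eq_bigr => a _; rewrite -MH.
have rankM : (\rank M <= minn n (h * k))%N by rewrite leq_min rank_leq_col rank_leq_row.
rewrite dimE; split=> [[rM rb rab]|[Hinj rM]].
  split; last by apply/eqP; rewrite eqn_leq rankM.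
  move=> a b Hab; apply/eqP; apply: contraT => /rab.
  have sub : (col_mx (block a M) (block b M) <= block a M)%MS.
    by rewrite col_mx_sub submx_refl -row_span_sub MH MH Hab subvv.
  rewrite ltnNge => /negP[]; apply: leq_trans (mxrankS sub) _.
  exact: rank_leq_row.
split; first by rewrite rM.
  by move=> a; rewrite (eqP (spans_row_free (MH a))).
move=> a b; apply: contraR; rewrite -leqNgt => rab.
have sub c : (block c M <= col_mx (block a M) (block b M))%MS ->
    (block c M == col_mx (block a M) (block b M))%MS.
  move=> s; rewrite -(geq_leqif (mxrank_leqif_eq s)).
  by rewrite (eqP (spans_row_free (MH c))).
apply/eqP/Hinj; apply: val_inj; rewrite -!MH; apply/eqP; rewrite row_span_eq.
have := submx_refl (col_mx (block a M) (block b M)).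
rewrite col_mx_sub => /andP[/sub/eqmxP ea /sub/eqmxP eb].
by apply/eqmxP; apply: eqmx_trans ea (eqmx_sym eb).
Qed.

End Blocks.

(** * Genericity of the rank conditions *)

Section RankOpen.
Variables (K : numFieldType) (N m n r : nat) (f : 'I_m -> 'I_N).

Lemma rowsub_rank_near (M : 'M[K]_(N, n)) : (r <= \rank (rowsub f M))%N ->
  \forall M' \near M, (r <= \rank (rowsub f M'))%N.
Proof.
move=> rM; have [P [Q PQ]] := rank_ge_mul1 rM.
have crow : continuous (rowsub f : 'M[K]_(N, n) -> 'M[K]_(m, n)).
  by apply: cts_mx => i j; under eq_fun do rewrite mxE; exact: coord_continuous.
have cdet : continuous (fun M' : 'M[K]_(N, n) => \det (P *m rowsub f M' *m Q)).
  apply: cts_det; apply: cts_mulmx; last exact: cst_continuous.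
  by apply: cts_mulmx => //; exact: cst_continuous.
have : \forall M' \near M, \det (P *m rowsub f M' *m Q) != 0.
  apply: (@cvgr_neq0 K K _ (nbhs M) _ (fun M' => \det (P *m rowsub f M' *m Q)) _ (cdet M)).
  by rewrite PQ det1 oner_neq0.
by apply: filterS => M'; exact: det_rank_ge.
Qed.

End RankOpen.

Section ConfFramesOpen.
Variables (K : numFieldType) (h k n : nat).

Lemma conf_frames_near (M : 'M[K]_(h * k, n)) : conf_frames M -> \forall M' \near M, conf_frames M'.
Proof.
move=> [rM rb rp].
have nM : \forall M' \near M, (minn n (h * k) <= \rank M')%N.
  have /rowsub_rank_near : (minn n (h * k) <= \rank (rowsub id M))%N by rewrite rowsub_id.
  by apply: filterS => M'; rewrite rowsub_id.
have nb : \forall M' \near M, forall a, (k <= \rank (block a M'))%N.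
  by apply: (filter_forall (nbhs_filter M)) => a; exact: rowsub_rank_near (rb a).
have np : \forall M' \near M, forall a b, a != b ->
    (k < \rank (col_mx (block a M') (block b M')))%N.
  apply: (filter_forall (nbhs_filter M)) => a; apply: (filter_forall (nbhs_filter M)) => b.
  have [->|ab] := eqVneq a b; first exact: nearW.
  have := rp a b ab; rewrite -pair_rowsub => /rowsub_rank_near.
  by apply: filterS => M'; rewrite pair_rowsub.
near=> M'; split.
- by near: M'.
- by near: M'.
- by near: M'.
Unshelve. all: by end_near. Qed.

Lemma conf_frames_open : open (@conf_frames K h k n).
Proof. by rewrite openE => M /conf_frames_near. Qed.

End ConfFramesOpen.

Section ConfFramesRich.
Variables (R : realType) (h k n : nat).
Local Notation C := (complex_numfield R).
Local Notation V := 'M[C]_(h * k, n).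

Lemma rowsub_rank_rich m r (f : 'I_m -> 'I_(h * k)) : injective f ->
  (r < m)%N || (r < n)%N ->
  @pencil_rich C V (fun M => (r <= \rank (rowsub f M))%N).
Proof.
move=> f_inj rmn; have := @rank_cond_rich R[i] (h * k) n m _ r (row_free_rowsub1 _ f_inj) rmn.
by congr (pencil_rich _); apply/funext => M; rewrite /rank_cond mul_rowsub_mx mul1mx.
Qed.

Lemma rowsub_rank_line_cofinite m r (f : 'I_m -> 'I_(h * k)) :
  @line_cofinite C V (fun M => (r <= \rank (rowsub f M))%N).
Proof.
have := @rank_cond_line_cofinite R[i] (h * k) n m (rowsub f 1%:M) r.
by congr (line_cofinite _); apply/funext => M; rewrite /rank_cond mul_rowsub_mx mul1mx.
Qed.

(** Each of the rank conditions concerns a submatrix formed by rows, and its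
    bound is below one of the two dimensions of that submatrix: min(n, h k)
    because n <> h k, k because k < n, and k + 1 because either k >= 2, and then
    k + 1 < 2 k, or k = 1, and then 2 < n. *)
Lemma conf_frames_rich : (0 < k)%N -> (k < n)%N -> n <> (h * k)%N -> n <> 2 ->
  @pencil_rich C V (@conf_frames C h k n).
Proof.
move=> k0 kn nhk n2.
pose T := (unit + 'I_h + 'I_h * 'I_h)%type.
pose S (t : T) (M : V) : Prop := match t with
  | inl (inl _) => (minn n (h * k) <= \rank (rowsub id M))%N
  | inl (inr a) => (k <= \rank (block a M))%N
  | inr (a, b) => a != b -> (k < \rank (rowsub (pair_index a b) M))%N
  end.
have -> : @conf_frames C h k n = (fun M => forall t, S t M).
  apply/funext => M; apply/propext; split.
    move=> [rM rb rp] [[u|a]|[a b]] /=; first by rewrite rowsub_id.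
      exact: rb.
    by rewrite pair_rowsub; exact: rp.
  move=> SM; split.
  - by have := SM (inl (inl tt)); rewrite /= rowsub_id.
  - by move=> a; exact: (SM (inl (inr a))).
  - by move=> a b; have := SM (inr (a, b)); rewrite /= pair_rowsub.
apply: pencil_rich_all => -[[u|a]|[a b]].
- by apply: rowsub_rank_rich => //; lia.
- apply: rowsub_rank_rich; first by move=> i j /mxvec_index_inj[].
  by rewrite kn orbT.
- have [->|ab] := eqVneq a b.
    have Sbb M : S (inr (b, b)) M by rewrite /S /= eqxx.
    split=> [x _|x w d _]; first by exists 0 => ? ? _; exact: Sbb.
    by exists [::] => c _ ? ? _; exact: Sbb.
  have := @rowsub_rank_rich _ k.+1 _ (pair_index_inj ab).
  have -> : S (inr (a, b)) = (fun M => (k < \rank (rowsub (pair_index a b) M))%N).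
    by apply/funext => M; apply/propext; split=> [SM|rM _]; [exact: SM | exact: rM].
  by apply; lia.
Qed.

Lemma conf_frames_line_cofinite : @line_cofinite C V (@conf_frames C h k n).
Proof.
move=> M D [rM rb rp].
have cM : cofinitely (fun c : C => (minn n (h * k) <= \rank (M + c *: D)%R)%N).
  have := @rowsub_rank_line_cofinite _ (minn n (h * k)) id M D.
  rewrite rowsub_id => /(_ rM); apply: cofinitely_mono => c.
  by rewrite rowsub_id.
have cb := @cofinitely_all C _ (enum 'I_h) (fun a c => (k <= \rank (block a (M + c *: D)))%N)
  (fun a _ => @rowsub_rank_line_cofinite _ k _ M D (rb a)).
have cp := @cofinitely_all C ('I_h * 'I_h)%type (enum {: 'I_h * 'I_h})
  (fun ab c => ab.1 != ab.2 -> (k < \rank (rowsub (pair_index ab.1 ab.2) (M + c *: D)))%N).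
have {}cp : cofinitely (fun c : C => forall ab, ab \in enum {: 'I_h * 'I_h} ->
   ab.1 != ab.2 -> (k < \rank (rowsub (pair_index ab.1 ab.2) (M + c *: D)))%N).
  apply: cp => -[a b] _ /=; have [->|ab] := eqVneq a b; first by exists [::].
  have := @rowsub_rank_line_cofinite _ k.+1 (pair_index a b) M D.
  by rewrite pair_rowsub => /(_ (rp a b ab)); apply: cofinitely_mono.
apply: cofinitely_mono (cofinitely_and cM (cofinitely_and cb cp)) => c [? [Hb Hp]]; split=> //.
  by move=> a; apply: Hb; rewrite mem_enum.
by move=> a b ab; rewrite -pair_rowsub; apply: (Hp (a, b)); rewrite ?mem_enum.
Qed.

End ConfFramesRich.

(** * The projection to the configuration space *)

Section Pointwise.
Variables (J : Type) (T Y : topologicalType).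

Lemma ptws_continuous (f : T -> {ptws J -> Y}) :
  (forall j, continuous (fun t => f t j)) -> continuous f.
Proof.
move=> cf t; apply/cvg_sup => j.
apply: (@continuous_comp_initial _ _ _ (fun g : J -> Y => g j) f).
exact: cf.
Qed.

End Pointwise.

Lemma path_homotopic_comp (R : realType) (T S : topologicalType) (F : T -> S)
    (x y : T) (f g : unit_itv R -> T) : continuous F ->
  path_homotopic x y f g -> path_homotopic (F x) (F y) (F \o f) (F \o g).
Proof.
move=> cF [H [cH H0 H1 Hx Hy]]; exists (F \o H); split => [|t|t|s|s] /=.
- exact: comp_cts.
- by rewrite H0.
- by rewrite H1.
- by rewrite Hx.
- by rewrite Hy.
Qed.

Section Projection.
Variables (R : realType) (h k n : nat).
Local Notation I := (unit_itv R).
Local Notation C := (complex_numfield R).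
Local Notation X := (set_type (@conf_frames C h k n)).
Local Notation conf := (configuration_dim R h k n (minn n (h * k))).

Lemma conf_frames_block_row_free (M : X) a : row_free (block a (val M)).
Proof.
have [_ rb _] := set_type_in M.
by rewrite /row_free eqn_leq rank_leq_row rb.
Qed.

Definition block_frame (M : X) (a : 'I_h) : frame C k n :=
  exist (fun F => F \in [set F : 'M[C]_(k, n) | free (frame_rows F)])
    (block a (val M)) (mem_set (row_free_free (conf_frames_block_row_free M a))).

Definition block_spaces (M : X) : {ptws 'I_h -> Gr C k n} :=
  fun a => frame_span (block_frame M a).

Lemma block_spaces_spans M a : spans (block a (val M)) (block_spaces M a).
Proof. by []. Qed.

Lemma block_spaces_in (M : X) : injective (block_spaces M) /\
  \dim (\sum_(a < h) val (block_spaces M a))%VS = minn n (h * k).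
Proof. by apply/(conf_framesP (block_spaces_spans M)); exact: set_type_in. Qed.

Definition conf_proj : X -> conf := corestrict block_spaces_in.

Lemma conf_proj_continuous : continuous conf_proj.
Proof.
apply: corestrict_continuous; apply: ptws_continuous => a.
apply: (@comp_cts _ _ _ (@frame_span C k n)); first exact: frame_span_continuous.
apply: continuous_comp_initial.
apply: (@comp_cts _ _ _ (block a) (val : X -> _)); first exact: cts_block.
exact: set_val_continuous.
Qed.

Lemma conf_projP (M : X) (H : conf) :
  conf_proj M = H <-> forall a, spans (block a (val M)) (val H a).
Proof.
split=> [<- a|MH]; first exact: block_spaces_spans.
apply: val_inj; apply/funext => a.
exact: spans_unique (block_spaces_spans M a) (MH a).
Qed.

Lemma conf_frames_of_spans (M : 'M[C]_(h * k, n)) (H : conf) :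
  (forall a, spans (block a M) (val H a)) -> conf_frames M.
Proof. by move=> /conf_framesP ->; exact: (set_valP H). Qed.

Lemma conf_proj_surj (H : conf) : exists M, conf_proj M = H.
Proof.
pose M := assemble (fun a => val (Gr_frame (val H a))).
have MH a : spans (block a M) (val H a) by rewrite block_assemble; exact: spans_Gr_frame.
exists (exist (fun M => M \in @conf_frames C h k n) M (mem_set (conf_frames_of_spans MH))).
exact/conf_projP.
Qed.

Lemma conf_path_lift (g : I -> conf) (M : X) : continuous g -> conf_proj M = g zero ->
  exists f : I -> X, [/\ continuous f, f zero = M & forall t, conf_proj (f t) = g t].
Proof.
move=> cg /conf_projP Mg.
have cga a : continuous (fun t => val (g t) a).
  have cval : continuous (fun t => val (g t) : {ptws 'I_h -> Gr C k n}).
    by apply: (@comp_cts _ _ conf val g) => //; exact: set_val_continuous.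
  apply: (@comp_cts _ _ {ptws 'I_h -> Gr C k n} (fun x => x a) _ _ cval).
  exact: (@function_spaces.proj_continuous _ (fun=> Gr C k n) a).
have [f fP] := choice (fun a => Gr_path_lift (cga a) (Mg a)).
pose F t := assemble (fun a => f a t).
have Fg t a : spans (block a (F t)) (val (g t) a).
  by rewrite block_assemble; have [_ _] := fP a; exact.
exists (corestrict (fun t => conf_frames_of_spans (Fg t))); split.
- apply: corestrict_continuous; apply: cts_assemble => a.
  by have [] := fP a.
- apply: val_inj; apply/matrixP => r l; case/mxvec_indexP: r => a j.
  rewrite [LHS]assembleE; have [_ -> _] := fP a; by rewrite mxE.
- by move=> t; apply/conf_projP => a; exact: Fg.
Qed.

(** The rows of a block of M + c (N - M) lie in the common row span of that block
    in M and N, and they span it unless a determinant vanishes at c. *)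
Lemma conf_fiber_path (M N : X) : conf_proj M = conf_proj N -> exists f : I -> X,
  [/\ continuous f, f zero = M, f one = N & forall t, conf_proj (f t) = conf_proj M].
Proof.
move=> MN; pose H := conf_proj M.
have MH a : spans (block a (val M)) (val H a) by exact: block_spaces_spans.
have NH a : spans (block a (val N)) (val H a) by have /esym/conf_projP := MN; exact.
pose P (L : 'M[C]_(h * k, n)) := forall a, spans (block a L) (val H a).
have cP : cofinitely (fun c => P (line (val M) (val N) c)).
  have rM a : (k <= \rank (rowsub (mxvec_index a) (val M)))%N.
    by rewrite (eqP (conf_frames_block_row_free M a)).
  have := @cofinitely_all C _ (enum 'I_h) _ (fun a _ =>
    @rowsub_rank_line_cofinite R h k n _ k _ (val M) (val N - val M) (rM a)).
  apply: cofinitely_mono => c rc a; have {}rc := rc a (mem_enum _ a).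
  set L := line _ _ _; have sub : (block a L <= block a (val M))%MS.
    have -> : block a L = block a (val M) + c *: (block a (val N) - block a (val M)).
      by apply/matrixP => i j; rewrite !mxE.
    rewrite addmx_sub// scalemx_sub// addmx_sub ?eqmx_opp//.
    by rewrite -row_span_sub MH NH subvv.
  rewrite /spans -MH; apply/eqP; rewrite row_span_eq -(geq_leqif (mxrank_leqif_eq sub)).
  by rewrite (eqP (conf_frames_block_row_free M a)).
have [eta eta01 etaP] := arc_path MH NH cP.
pose F (t : I) := line (val M) (val N) (arc eta (val t)).
have FP (t : I) : P (F t) by exact: etaP.
exists (corestrict (fun t => conf_frames_of_spans (FP t))); split.
- by apply: corestrict_continuous; exact: arc_path_continuous.
- by apply: val_inj; rewrite -[LHS]/(F zero) /F zeroE val_clamp// arc0 line0.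
- by apply: val_inj; rewrite -[LHS]/(F one) /F oneE val_clamp// arc1 line1.
- by move=> t; apply/conf_projP => a; exact: FP.
Qed.

Lemma conf_path_connected (x y : conf) :
  exists f : I -> conf, [/\ continuous f, f zero = x & f one = y].
Proof.
have [M Mx] := conf_proj_surj x; have [N Ny] := conf_proj_surj y.
have [|||eta eta01 etaP] := @arc_path R _ _ (@conf_frames C h k n) (val M) (val N).
- exact: set_type_in.
- exact: set_type_in.
- by apply: conf_frames_line_cofinite; exact: set_type_in.
pose F := corestrict etaP; exists (conf_proj \o F); split.
- apply: comp_cts; first exact: conf_proj_continuous.
  by apply: corestrict_continuous; exact: arc_path_continuous.
- rewrite -Mx /=; congr conf_proj; apply: val_inj.
  by rewrite -[LHS]/(line _ _ (arc eta (val (zero : I)))) zeroE val_clamp// arc0 line0.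
- rewrite -Ny /=; congr conf_proj; apply: val_inj.
  by rewrite -[LHS]/(line _ _ (arc eta (val (one : I)))) oneE val_clamp// arc1 line1.
Qed.

(** The lift of g is closed up by a path d inside the fibre, which the projection
    sends to a constant path. *)
Lemma conf_null_homotopic (x : conf) (g : I -> conf) :
  (0 < k)%N -> (k < n)%N -> n <> (h * k)%N -> n <> 2 ->
  continuous g -> g zero = x -> g one = x -> path_homotopic x x g (cst x).
Proof.
move=> k0 kn nhk n2 cg g0 g1.
have [M Mx] := conf_proj_surj x.
have [|f [cf f0 fg]] := conf_path_lift (M := M) cg; first by rewrite g0.
have [|d [cd d0 d1 dx]] := conf_fiber_path (M := f one) (N := M); first by rewrite fg g1.
have cfd : continuous (concat f d) by apply: concat_continuous.
have null : path_homotopic M M (concat f d) (cst M).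
  apply: rich_null_homotopic => //.
  - exact: conf_frames_open.
  - exact: conf_frames_rich.
  - by rewrite concat0.
  - by rewrite concat1.
have := path_homotopic_comp conf_proj_continuous null; rewrite Mx.
have -> : conf_proj \o concat f d = concat g (cst x).
  apply/funext => t; rewrite /concat /=; case: ifP => _; first exact: fg.
  by rewrite dx fg.
have -> : conf_proj \o cst M = cst x :> (I -> conf) by apply/funext => t.
apply: path_homotopic_trans; apply: path_homotopic_sym.
exact: path_homotopic_concatp1.
Qed.

End Projection.

(** * Isomorphisms of fundamental groups *)

Lemma isomorphic_groups_intro (G H : groupType) (f : G -> H) (g : H -> G) :
  {morph f : a b / (a * b)%g} -> cancel f g -> cancel g f -> isomorphic_groups G H.
Proof.
move=> fM fK gK.
pose F : {multiplicative G -> H} := HB.pack f (isMultiplicative.Build G H f fM).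
by exists F; exists g.
Qed.

Lemma isomorphic_groups_trans (G H L : groupType) :
  isomorphic_groups G H -> isomorphic_groups H L -> isomorphic_groups G L.
Proof.
move=> [f bij_f] [g bij_g]; exists (g \o f).
exact: bij_comp.
Qed.

Section InducedMap.
Variables (R : realType) (T S : topologicalType) (F : T -> S) (x : T) (y : S).
Local Notation I := (unit_itv R).
Hypotheses (cF : continuous F) (Fxy : F x = y).

Lemma map_loop_subproof (p : loop R x) :
  [/\ continuous (F \o p), (F \o p) zero = y & (F \o p) one = y].
Proof.
by split; rewrite /= ?path_zero ?path_one//; apply: comp_cts => //; exact: loop_cts.
Qed.

Definition map_loop (p : loop R x) : loop R y :=
  let: And3 c p0 p1 := map_loop_subproof p in mk_path c p0 p1.

Lemma map_loopE p : map_loop p = F \o p :> (I -> S).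
Proof. by rewrite /map_loop; case: map_loop_subproof. Qed.

Definition map_pi1 (a : pi1 R x) : pi1 R y := \pi_(pi1 R y) (map_loop (repr a)).

Lemma map_pi1E p : map_pi1 (\pi_(pi1 R x) p) = \pi_(pi1 R y) (map_loop p).
Proof.
apply/pi1_eqP; rewrite !map_loopE -Fxy.
by apply: path_homotopic_comp => //; exact: repr_pi1.
Qed.

Lemma map_pi1M : {morph map_pi1 : a b / (a * b)%g}.
Proof.
elim/quotW => p; elim/quotW => q.
rewrite -[(_ * _)%g]/(pi1_mul _ _) -[RHS]/(pi1_mul _ _) pi1_mulE !map_pi1E pi1_mulE.
congr (\pi_(pi1 R y) _); apply/path_eqP => t.
by rewrite map_loopE !loop_mulE /concat /= !map_loopE /=; case: ifP.
Qed.

End InducedMap.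

Lemma homeomorphic_pi1 (R : realType) (T S : topologicalType) (F : T -> S) (G : S -> T)
    (x : T) : continuous F -> continuous G -> cancel F G -> cancel G F ->
  isomorphic_groups (pi1 R x) (pi1 R (F x)).
Proof.
move=> cF cG FK GK.
apply: (@isomorphic_groups_intro _ _ (map_pi1 cF erefl) (map_pi1 cG (FK x))).
- exact: map_pi1M.
- elim/quotW => p; rewrite (map_pi1E cF erefl p) map_pi1E; congr (\pi_(pi1 R x) _).
  by apply/path_eqP => t; rewrite !map_loopE /= FK.
- elim/quotW => p; rewrite (map_pi1E cG (FK x) p) map_pi1E; congr (\pi_(pi1 R (F x)) _).
  by apply/path_eqP => t; rewrite !map_loopE /= GK.
Qed.

Section BaseChange.
Variables (R : realType) (T : topologicalType).
Local Notation I := (unit_itv R).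

Definition is_path (x y : T) (f : I -> T) :=
  [/\ continuous f, f zero = x & f one = y].

Lemma is_path_concat x y z f g :
  is_path x y f -> is_path y z g -> is_path x z (concat f g).
Proof.
move=> [cf f0 f1] [cg g0 g1]; split; rewrite ?concat0 ?concat1//.
by apply: concat_continuous; rewrite ?f1.
Qed.

Lemma is_path_opp x y f : is_path x y f -> is_path y x (f \o @unit_itv_opp R).
Proof.
move=> [cf f0 f1]; split; rewrite /= ?unit_itv_opp0 ?unit_itv_opp1//.
by apply: comp_cts => //; exact: unit_itv_opp_continuous.
Qed.

Lemma is_path_homotopic_refl x y f : is_path x y f -> path_homotopic x y f f.
Proof. by case; exact: path_homotopic_refl. Qed.

Lemma concat_assoc x y z w f g h : is_path x y f -> is_path y z g -> is_path z w h ->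
  path_homotopic x w (concat f (concat g h)) (concat (concat f g) h).
Proof. by move=> [? ? ?] [? ? ?] [? ? ?]; exact: (path_homotopic_concatA (y := y) (z := z)). Qed.

Lemma concat_cancel_left x y z d f : is_path x y d -> is_path x z f ->
  path_homotopic x z (concat d (concat (d \o @unit_itv_opp R) f)) f.
Proof.
move=> pd pf; have pd' := is_path_opp pd.
apply: path_homotopic_trans (concat_assoc pd pd' pf) _.
have [cd d0 d1] := pd; have [cf f0 f1] := pf.
apply: path_homotopic_trans (path_homotopic_concat
  (path_homotopic_concatpV cd d0 d1) (is_path_homotopic_refl pf)) _.
exact: path_homotopic_concat1p.
Qed.

Lemma concat_cancel_right x y z d f : is_path x y d -> is_path z x f ->
  path_homotopic z x (concat (concat f d) (d \o @unit_itv_opp R)) f.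
Proof.
move=> pd pf; have pd' := is_path_opp pd.
apply: path_homotopic_trans (path_homotopic_sym (concat_assoc pf pd pd')) _.
have [cd d0 d1] := pd; have [cf f0 f1] := pf.
apply: path_homotopic_trans (path_homotopic_concat
  (is_path_homotopic_refl pf) (path_homotopic_concatpV cd d0 d1)) _.
exact: path_homotopic_concatp1.
Qed.

(** Transport of loops along d, which changes the base point. *)
Definition conj_path (d p : I -> T) : I -> T :=
  concat (d \o @unit_itv_opp R) (concat p d).

Lemma loop_is_path x (p : loop R x) : is_path x x p.
Proof. by split; rewrite ?path_zero ?path_one//; exact: loop_cts. Qed.

Lemma conj_path_is_path x y d p : is_path x y d -> is_path x x p ->
  is_path y y (conj_path d p).
Proof.
move=> pd pp; apply: is_path_concat (is_path_opp pd) _.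
exact: is_path_concat pp pd.
Qed.

Lemma conj_path_homotopic x y d p q : is_path x y d -> path_homotopic x x p q ->
  path_homotopic y y (conj_path d p) (conj_path d q).
Proof.
move=> pd pq; apply: path_homotopic_concat (is_path_homotopic_refl (is_path_opp pd)) _.
exact: path_homotopic_concat pq (is_path_homotopic_refl pd).
Qed.

Lemma conj_path_concat x y d p q : is_path x y d -> is_path x x p -> is_path x x q ->
  path_homotopic y y (conj_path d (concat p q)) (concat (conj_path d p) (conj_path d q)).
Proof.
move=> pd pp pq; have pd' := is_path_opp pd.
have pqd := is_path_concat pq pd; have ppd := is_path_concat pp pd.
have pcq := conj_path_is_path pd pq.
apply: path_homotopic_sym.
apply: path_homotopic_trans (path_homotopic_sym (concat_assoc pd' ppd pcq)) _.
apply: path_homotopic_concat (is_path_homotopic_refl pd') _.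
apply: path_homotopic_trans (path_homotopic_sym (concat_assoc pp pd pcq)) _.
apply: path_homotopic_trans (path_homotopic_concat (is_path_homotopic_refl pp)
  (concat_cancel_left pd pqd)) _.
exact: concat_assoc pp pq pd.
Qed.

Lemma conj_pathK x y d p : is_path x y d -> is_path x x p ->
  path_homotopic x x (conj_path (d \o @unit_itv_opp R) (conj_path d p)) p.
Proof.
move=> pd pp; have pd' := is_path_opp pd; have ppd := is_path_concat pp pd.
rewrite /conj_path.
have -> : (d \o @unit_itv_opp R) \o @unit_itv_opp R = d.
  by apply/funext => t; rewrite /= unit_itv_oppK.
apply: path_homotopic_trans (path_homotopic_concat (is_path_homotopic_refl pd)
  (path_homotopic_sym (concat_assoc pd' ppd pd'))) _.
apply: path_homotopic_trans (concat_cancel_left pd (is_path_concat ppd pd')) _.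
exact: concat_cancel_right pd pp.
Qed.

Definition conj_loop x y d (pd : is_path x y d) (p : loop R x) : loop R y :=
  let: And3 c p0 p1 := conj_path_is_path pd (loop_is_path p) in mk_path c p0 p1.

Lemma conj_loopE x y d (pd : is_path x y d) p :
  conj_loop pd p = conj_path d p :> (I -> T).
Proof. by rewrite /conj_loop; case: conj_path_is_path. Qed.

Definition conj_pi1 x y d (pd : is_path x y d) (a : pi1 R x) : pi1 R y :=
  \pi_(pi1 R y) (conj_loop pd (repr a)).

Lemma conj_pi1E x y d (pd : is_path x y d) p :
  conj_pi1 pd (\pi_(pi1 R x) p) = \pi_(pi1 R y) (conj_loop pd p).
Proof.
apply/pi1_eqP; rewrite !conj_loopE; apply: conj_path_homotopic pd _.
exact: repr_pi1.
Qed.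

Lemma conj_pi1K x y d (pd : is_path x y d) :
  cancel (conj_pi1 pd) (conj_pi1 (is_path_opp pd)).
Proof.
elim/quotW => p; rewrite (conj_pi1E pd p) conj_pi1E; apply/pi1_eqP; rewrite !conj_loopE.
by apply: conj_pathK pd _; exact: loop_is_path.
Qed.

Lemma base_change_pi1 x y d : is_path x y d ->
  isomorphic_groups (pi1 R x) (pi1 R y).
Proof.
move=> pd; apply: (@isomorphic_groups_intro _ _ (conj_pi1 pd) (conj_pi1 (is_path_opp pd))).
- elim/quotW => p; elim/quotW => q.
  rewrite -[(_ * _)%g]/(pi1_mul _ _) -[RHS]/(pi1_mul _ _) pi1_mulE !conj_pi1E pi1_mulE.
  apply/pi1_eqP; rewrite loop_mulE !conj_loopE.
  by apply: conj_path_concat pd _ _; exact: loop_is_path.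
- exact: conj_pi1K.
- elim/quotW => p; rewrite (conj_pi1E (is_path_opp pd) p) conj_pi1E; apply/pi1_eqP; rewrite !conj_loopE.
  have dK : (d \o @unit_itv_opp R) \o @unit_itv_opp R = d.
    by apply/funext => t; rewrite /= unit_itv_oppK.
  rewrite -[X in conj_path X _]dK.
  by apply: conj_pathK (is_path_opp pd) _; exact: loop_is_path.
Qed.

End BaseChange.

Section Lines.
Variables (R : realType) (h : nat).
Hypothesis h2 : (2 <= h)%N.

(** If the sum had dimension at most 1, then all the lines, of which there are at
    least two, would be equal to it. *)
Lemma dim_sum_lines (H : 'I_h -> Gr R[i] 1 2) : injective H ->
  \dim (\sum_(a < h) val (H a))%VS = 2.
Proof.
move=> Hinj; apply/eqP; rewrite eqn_leq.
have dim2 (U : {vspace 'rV[R[i]]_2}) : (\dim U <= 2)%N.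
  by have := dimvS (subvf U); rewrite dimvf /dim /=.
rewrite dim2 ltnNge; apply/negP => dim1.
have Hsum a : val (H a) = (\sum_(a < h) val (H a))%VS.
  apply/eqP; rewrite eqEdim (sumv_sup a)//=.
  by rewrite (eqP (valP (H a))).
pose a0 : 'I_h := Ordinal (ltnW h2); pose a1 : 'I_h := Ordinal h2.
have : a0 = a1 by apply/Hinj/val_inj; rewrite !Hsum.
by move/(congr1 val).
Qed.

Lemma configuration_dim_lines_homeo :
  exists (F : configuration_dim R h 1 2 2 -> configuration h (CP1 R)) G,
    [/\ continuous F, continuous G, cancel F G & cancel G F].
Proof.
have FS (x : configuration_dim R h 1 2 2) : injective (val x : 'I_h -> CP1 R).
  by have [] := set_valP x.
have GS (x : configuration h (CP1 R)) : injective (val x : 'I_h -> Gr R[i] 1 2) /\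
    \dim (\sum_(a < h) val (val x a))%VS = 2.
  by have xinj := set_valP x; split=> //; exact: dim_sum_lines.
exists (corestrict (S := [set x : {ptws 'I_h -> CP1 R} | injective x]) FS).
exists (corestrict (S := [set H : {ptws 'I_h -> Gr R[i] 1 2} |
  injective H /\ \dim (\sum_(a < h) val (H a))%VS = 2]) GS).
split.
- by apply: corestrict_continuous; exact: set_val_continuous.
- by apply: corestrict_continuous; exact: set_val_continuous.
- by move=> x; apply: val_inj.
- by move=> x; apply: val_inj.
Qed.

End Lines.

Local Close Scope ring_scope.
Unset Implicit Arguments.

Theorem corollary2p2 (R : realType) (n k h : nat)
    (k_gt0 : (0 < k)%N) (k_lt_n : (k < n)%N) (h_ge2 : (2 <= h)%N)
    (n_neq_hk : n <> (h * k)%N) :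
  let i := minn n (h * k) in
  (n <> 2 ->
    forall x : configuration_dim R h k n i, trivial_group (pi1 R x)) /\
  (n = 2 ->
    forall (x : configuration_dim R h k n i) (y : configuration h (CP1 R)),
      isomorphic_groups (pi1 R x) (pure_braid_group R y)).
Proof.
move=> i; split=> [n2 x|n2].
  elim/quotW => p; apply/pi1_eqP; rewrite loop_oneE.
  by apply: conf_null_homotopic; rewrite ?path_zero ?path_one//; exact: loop_cts.
subst n; have k1 : k = 1%N by lia.
subst k; have i2 : minn 2 (h * 1) = 2 by lia.
rewrite /i => x y.
have connected := @conf_path_connected R h 1 2.
move: x connected; rewrite i2 => x connected.
have [F [G [cF cG FK GK]]] := configuration_dim_lines_homeo R h_ge2.
have [d [cd d0 d1]] := connected x (G y).
apply: (@isomorphic_groups_trans _ (pi1 R (G y))).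
  by apply: (@base_change_pi1 _ _ _ _ d); split.
by have := homeomorphic_pi1 R (G y) cF cG FK GK; rewrite GK.
Qed.
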